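(* There exist finite sets of points $X_1,X_2\subset\mathbb{P}^1\times\mathbb{P}^1$ such that $X_1$ and $X_2$ are equivalent up to configuration, but $X_1$ is a virtual complete intersection and $X_2$ is not a virtual complete intersection.
   Context: Let $\Bbbk$ be an algebraically closed field; $\mathbb{P}^1\times\mathbb{P}^1$ is over $\Bbbk$, with projections $\pi_1,\pi_2$ to the first and second factor. A vertical ruling is a fiber of $\pi_1$ and a horizontal ruling is a fiber of $\pi_2$. Two finite sets of points $X_1,X_2$ are equivalent up to configuration if they have the same configuration on the grid of rulings after permuting and relabeling the rulings, i.e. there are bijections $\sigma:\pi_1(X_1)\to\pi_1(X_2)$ and $\tau:\pi_2(X_1)\to\pi_2(X_2)$ such that for all $a\in\pi_1(X_1)$, $b\in\pi_2(X_1)$: $(a,b)\in X_1$ if and only if $(\sigma(a),\tau(b))\in X_2$. The Cox ring is $S=\Bbbk[x_0,x_1,y_0,y_1]$, $\mathbb{Z}^2$-graded with $\deg x_i=(1,0)$ and $\deg y_i=(0,1)$, and $B=\langle x_0,x_1\rangle\cap\langle y_0,y_1\rangle$ is the irrelevant ideal. A set of points means a reduced zero-dimensional subscheme $X$ of $\mathbb{P}^1\times\mathbb{P}^1$; $I_X\subset S$ is the $B$-saturated bihomogeneous ideal of polynomials vanishing on $X$. A virtual resolution of $S/I$ ($I$ a bihomogeneous ideal) is a $\mathbb{Z}^2$-graded complex of free $S$-modules $F_\bullet=[F_0\xleftarrow{\varphi_1}F_1\xleftarrow{\varphi_2}F_2\leftarrow\cdots]$ such that for every $i\ge 1$ the annihilator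 of $H_i(F_\bullet)$ contains $B^\ell$ for some $\ell>0$, and the sheaves on $\mathbb{P}^1\times\mathbb{P}^1$ associated to $S/I$ and $\operatorname{coker}(\varphi_1)$ are isomorphic. The set $X$ is a virtual complete intersection (VCI) if $S/I_X$ has a virtual resolution that is the Koszul complex $K(f,g)$ of two bihomogeneous forms $f,g\in S$. *)

(* Defs.v *)
From HB Require Import structures.
From mathcomp Require Import all_boot all_order all_algebra.
From mathcomp Require Import finmap.
From mathcomp Require Import mpoly.

Set Implicit Arguments.
Unset Strict Implicit.
Unset Printing Implicit Defensive.

Import Order.TTheory GRing.Theory Num.Theory.
Local Open Scope ring_scope.

Definition P1 (k : fieldType) : choiceType :=
  {L : {vspace 'rV[k]_2} | \dim L == 1%N}.

Definition pi1 (k : fieldType) (X : {fset P1 k * P1 k}) : {fset P1 k} :=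
  [fset p.1 | p in X]%fset.

Definition pi2 (k : fieldType) (X : {fset P1 k * P1 k}) : {fset P1 k} :=
  [fset p.2 | p in X]%fset.

Definition equiv_config (k : fieldType) (X1 X2 : {fset P1 k * P1 k}) : Prop :=
  exists (sigma : pi1 X1 -> pi1 X2) (tau : pi2 X1 -> pi2 X2),
    [/\ bijective sigma, bijective tau &
        forall (a : pi1 X1) (b : pi2 X1),
          ((val a, val b) \in X1) = ((val (sigma a), val (tau b)) \in X2)].

(* The first block of two variables is x_0, x_1, the second one y_0, y_1. *)
Definition cox (k : fieldType) := {mpoly k[2 + 2]}.

Definition xvar (k : fieldType) (i : 'I_2) : cox k := 'X_(lshift 2 i).
Definition yvar (k : fieldType) (i : 'I_2) : cox k := 'X_(rshift 2 i).

Definition mbideg (m : 'X_{1..2 + 2}) : int * int :=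
  ((\sum_(i < 2) m (lshift 2 i))%N%:Z, (\sum_(i < 2) m (rshift 2 i))%N%:Z).

(* The zero polynomial is bihomogeneous of every bidegree, and it is the only
   one whose bidegree may have a negative component. *)
Definition bihom (k : fieldType) (d : int * int) (f : cox k) : Prop :=
  forall m, m \in msupp f -> mbideg m = d.

Definition irrelevant (k : fieldType) (f : cox k) : Prop :=
  (exists c : 'I_2 -> cox k, f = \sum_i c i * xvar k i) /\
  (exists c : 'I_2 -> cox k, f = \sum_i c i * yvar k i).

Definition ideal_pow (k : fieldType) (I : cox k -> Prop) (l : nat)
    (f : cox k) : Prop :=
  exists (n : nat) (c : 'I_n -> cox k) (g : 'I_n -> 'I_l -> cox k),
    (forall i j, I (g i j)) /\ f = \sum_i c i * \prod_j g i j.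

(* Vanishing is tested on all bihomogeneous coordinates of each point; over an
   infinite field this says that every bihomogeneous component of f vanishes
   at the point. *)
Definition vanishing_ideal (k : fieldType) (X : {fset P1 k * P1 k})
    (f : cox k) : Prop :=
  forall (p : P1 k * P1 k) (a b : 'rV[k]_2), p \in X ->
    a \in val p.1 -> a != 0 -> b \in val p.2 -> b != 0 ->
    f.@[row_mx a b 0] = 0.

(* The bigraded module F / N, where F is free on generators of the bidegrees
   [gdeg] and N is the bigraded submodule [grel]. *)
Record bimod (k : fieldType) := Bimod {
  grank : nat;
  gdeg : 'I_grank -> int * int;
  grel : 'rV[cox k]_grank -> Prop
}.

Definition vbihom (k : fieldType) (n : nat) (gd : 'I_n -> int * int)
    (d : int * int) (v : 'rV[cox k]_n) : Prop :=
  forall j, bihom (d - gd j) (v 0 j).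

(* The sheaf M~ is described on the base of affine opens D_+(s), for s
   bihomogeneous with a bidegree having two positive components: its sections
   over D_+(s) are the module M_(s) of elements of bidegree 0 of M_s.
   An element v / s^n of M_(s) is encoded as the pair (n, v); the relation
   [sect_eq] is the equality of fractions. *)
Definition dopen (k : fieldType) (s : cox k) (e : int * int) : Prop :=
  [/\ bihom e s, 0 < e.1 & 0 < e.2].

Definition frac (k : fieldType) (M : bimod k) : Type :=
  (nat * 'rV[cox k]_(grank M))%type.

Definition is_sect (k : fieldType) (M : bimod k) (e : int * int)
    (u : frac M) : Prop :=
  vbihom (@gdeg k M) (e *+ u.1) u.2.

Definition sect_eq (k : fieldType) (M : bimod k) (s : cox k)
    (u v : frac M) : Prop :=
  exists n : nat, grel (s ^+ n *: (s ^+ v.1 *: u.2 - s ^+ u.1 *: v.2)).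

Definition sect_add (k : fieldType) (M : bimod k) (s : cox k)
    (u v : frac M) : frac M :=
  ((u.1 + v.1)%N, s ^+ v.1 *: u.2 + s ^+ u.1 *: v.2).

(* The pair a = (n, h) stands for the section h / s^n of the structure sheaf. *)
Definition sect_scale (k : fieldType) (M : bimod k) (a : nat * cox k)
    (u : frac M) : frac M :=
  ((a.1 + u.1)%N, a.2 *: u.2).

(* Restriction from D_+(s) to D_+(s * t). *)
Definition sect_res (k : fieldType) (M : bimod k) (t : cox k)
    (u : frac M) : frac M :=
  (u.1, t ^+ u.1 *: u.2).

(* Morphisms of sheaves of modules M~ -> N~, given on the base of the D_+(s).
   Since D_+(s') is contained in D_+(s) only if some s'^n is a multiple of s,
   and D_+(s') = D_+(s'^n), naturality with respect to the restrictions from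
   D_+(s) to D_+(s * t) is naturality with respect to all inclusions. *)
Record sheaf_mor (k : fieldType) (M N : bimod k)
    (phi : cox k -> int * int -> frac M -> frac N) : Prop := SheafMor {
  mor_sect : forall s e u, dopen s e ->
    is_sect e u -> is_sect e (phi s e u);
  mor_eq : forall s e u v, dopen s e -> is_sect e u -> is_sect e v ->
    sect_eq s u v -> sect_eq s (phi s e u) (phi s e v);
  mor_add : forall s e u v, dopen s e -> is_sect e u -> is_sect e v ->
    sect_eq s (phi s e (sect_add s u v))
              (sect_add s (phi s e u) (phi s e v));
  mor_scale : forall s e (a : nat * cox k) u, dopen s e ->
    bihom (e *+ a.1) a.2 -> is_sect e u ->
    sect_eq s (phi s e (sect_scale a u)) (sect_scale a (phi s e u));
  mor_res : forall s e t d u, dopen s e -> bihom d t ->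
    dopen (s * t) (e + d) -> is_sect e u ->
    sect_eq (s * t) (phi (s * t) (e + d) (sect_res t u))
                    (sect_res t (phi s e u))
}.

Definition sheaf_iso (k : fieldType) (M N : bimod k) : Prop :=
  exists (phi : cox k -> int * int -> frac M -> frac N)
         (psi : cox k -> int * int -> frac N -> frac M),
    [/\ sheaf_mor phi, sheaf_mor psi,
        forall s e u, dopen s e -> is_sect e u ->
          sect_eq s (psi s e (phi s e u)) u &
        forall s e v, dopen s e -> is_sect e v ->
          sect_eq s (phi s e (psi s e v)) v].

(* Elements of the i-th free module are row vectors, and the differential from
   degree i.+1 to degree i is v |-> v *m cdiff i; it has bidegree 0. *)
Record free_complex (k : fieldType) := FreeComplex {
  crank : nat -> nat;
  cdeg : forall i, 'I_(crank i) -> int * int;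
  cdiff : forall i, 'M[cox k]_(crank i.+1, crank i);
  cdiff_bihom : forall i j l, bihom (cdeg j - cdeg l) (cdiff i j l);
  cdiff_comp : forall i, cdiff i.+1 *m cdiff i = 0
}.

(* The annihilator of the homology in degree i.+1. *)
Definition ann_homology (k : fieldType) (F : free_complex k) (i : nat)
    (h : cox k) : Prop :=
  forall v : 'rV[cox k]_(crank F i.+1), v *m cdiff F i = 0 ->
    exists w : 'rV[cox k]_(crank F i.+2), h *: v = w *m cdiff F i.+1.

Definition quot_mod (k : fieldType) (I : cox k -> Prop) : bimod k :=
  @Bimod k 1 (fun=> 0) (fun v => I (v 0 0)).

Definition coker_mod (k : fieldType) (F : free_complex k) : bimod k :=
  @Bimod k (crank F 0) (@cdeg k F 0)
    (fun v => exists w : 'rV[cox k]_(crank F 1), v = w *m cdiff F 0).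

Definition virtual_resolution (k : fieldType) (I : cox k -> Prop)
    (F : free_complex k) : Prop :=
  (forall i : nat, exists2 l : nat, (0 < l)%N &
     forall h, ideal_pow (@irrelevant k) l h -> ann_homology F i h) /\
  sheaf_iso (quot_mod I) (coker_mod F).

Definition koszul_rank (i : nat) : nat :=
  match i with 0 => 1 | 1 => 2 | 2 => 1 | _ => 0 end.

Definition koszul_deg (df dg : int * int) (i : nat) :
    'I_(koszul_rank i) -> int * int :=
  match i return 'I_(koszul_rank i) -> int * int with
  | 0 => fun=> 0
  | 1 => fun j => if j == 0 then df else dg
  | 2 => fun=> df + dg
  | _ => fun=> 0
  end.

Definition koszul_diff (k : fieldType) (f g : cox k) (i : nat) :
    'M[cox k]_(koszul_rank i.+1, koszul_rank i) :=
  match i return 'M[cox k]_(koszul_rank i.+1, koszul_rank i) with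
  | 0 => \matrix_(j < 2, l < 1) (if j == 0 then f else g)
  | 1 => \matrix_(j < 1, l < 2) (if l == 0 then - g else f)
  | _ => 0
  end.

Lemma koszul_bihom (k : fieldType) (df dg : int * int) (f g : cox k)
    (hf : bihom df f) (hg : bihom dg g) i j l :
  bihom (@koszul_deg df dg i.+1 j - @koszul_deg df dg i l)
        (koszul_diff f g i j l).
Proof.
case: i j l => [|[|i]] j l /=; rewrite mxE.
- by case: ifP => _; rewrite subr0.
- case: ifP => _; last by rewrite addrK.
  by rewrite addrC addKr => m; rewrite (perm_mem (msuppN g)); apply: hg.
- by move=> m; rewrite msupp0.
Qed.

Lemma koszul_comp (k : fieldType) (f g : cox k) i :
  koszul_diff f g i.+1 *m koszul_diff f g i = 0.
Proof.
case: i => [|i] /=; last by rewrite mul0mx.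
apply/matrixP=> j l; rewrite !mxE big_ord_recl big_ord1 !mxE /=.
by rewrite mulNr [f * g]mulrC addNr.
Qed.

Definition koszul (k : fieldType) (df dg : int * int) (f g : cox k)
    (hf : bihom df f) (hg : bihom dg g) : free_complex k :=
  @FreeComplex k koszul_rank (koszul_deg df dg) (koszul_diff f g)
    (koszul_bihom hf hg) (koszul_comp f g).

Definition VCI (k : fieldType) (X : {fset P1 k * P1 k}) : Prop :=
  exists (df dg : int * int) (f g : cox k)
         (hf : bihom df f) (hg : bihom dg g),
    virtual_resolution (vanishing_ideal X) (koszul hf hg).

(* Main.v *)
Require Import Defs.
From HB Require Import structures.
From mathcomp Require Import all_boot all_order all_algebra.
From mathcomp Require Import finmap.
From mathcomp Require Import mpoly.
From mathcomp Require Import ring zify.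

(** A configuration of six points: four points [p_0, ..., p_3], no two of them
    on a common ruling, and two further points, on the vertical rulings of
    [p_0] and [p_1] and on a common fifth horizontal ruling [R].

    If the [p_i] lie on a smooth curve [q = 0] of bidegree (1, 1), then the
    points are the transversal intersection of this curve plus [R] with a union
    of four rulings, which has bidegree (2, 2); so they form a virtual complete
    intersection. The saturation [(f, g) : B^oo] is found to be the whole ideal
    because the ideals of distinct points are comaximal up to [B], so that their
    intersection agrees with their product.

    If the cross-ratios of the two coordinates of the [p_i] differ, then no such
    curve exists. Let [f] and [g], of bidegrees (a, b) and (c, d), cut out the
    points. In large bidegrees the forms modulo [(f, g)] are spanned by six
    Lagrange polynomials, one for each point, and the syzygy (g, -f) of [f] and
    [g] turns this into a d + b c <= 6. Restricting forms to the rulings with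
    two points excludes all such bidegrees except (1, 2), (2, 2), for which the
    first form would contain [R] and a curve of bidegree (1, 1) through the
    [p_i]. *)

Set Implicit Arguments.
Unset Strict Implicit.
Unset Printing Implicit Defensive.

Import Order.TTheory GRing.Theory Num.Theory.
Local Open Scope ring_scope.

Definition ideal2 (R : comNzRingType) (a b v : R) : Prop :=
  exists c d, v = c * a + d * b.

(** * Comaximal ideals *)

Section Ideal2.
Variable R : comNzRingType.
Implicit Types a b c u v w : R.

Lemma ideal2_l a b c : ideal2 a b (c * a).
Proof. by exists c, 0; ring. Qed.

Lemma ideal2_r a b c : ideal2 a b (c * b).
Proof. by exists 0, c; ring. Qed.

Lemma ideal2D a b u v : ideal2 a b u -> ideal2 a b v -> ideal2 a b (u + v).
Proof. by case=> [c [d ->]] [c' [d' ->]]; exists (c + c'), (d + d'); ring. Qed.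

Lemma ideal2M a b w u : ideal2 a b u -> ideal2 a b (w * u).
Proof. by case=> [c [d ->]]; exists (w * c), (w * d); ring. Qed.

Lemma ideal2_0 a b : ideal2 a b 0.
Proof. by exists 0, 0; ring. Qed.

Lemma ideal2C a b u : ideal2 a b u -> ideal2 b a u.
Proof. by case=> [c [d ->]]; exists d, c; ring. Qed.

(** The inclusion $(a,b)(a,c)\subseteq(a,bc)$: points on the curve [a] are collected by multiplying
    up the second equation. *)
Lemma ideal2_mul a b c u v :
  ideal2 a b u -> ideal2 a c v -> ideal2 a (b * c) (u * v).
Proof.
case=> [e [f ->]] [e' [f' ->]].
by exists (e * (e' * a + f' * c) + f * e' * b), (f * f'); ring.
Qed.

End Ideal2.

Definition saturated (R : comNzRingType) (s : R) (K : R -> Prop) : Prop :=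
  [/\ forall u v, K u -> K v -> K (u + v), forall w u, K u -> K (w * u) &
      forall u, K (s * u) -> K u].

(** The product of the ideals [P i] lies in [K]. Passing to the colon ideal [K : p] at each factor
    lets an induction vary [K] instead of tracking products. *)
Fixpoint products_in (R : comNzRingType) (I : Type) (P : I -> R -> Prop)
    (r : seq I) (K : R -> Prop) : Prop :=
  if r is i :: r' then
    forall p, P i p -> products_in P r' (fun v => K (p * v))
  else K 1.

Section Comaximal.
Variables (R : comNzRingType) (s : R) (I : eqType) (P : I -> R -> Prop).

Lemma saturated_colon p K : saturated s K -> saturated s (fun v => K (p * v)).
Proof.
case=> KD KM Ks; split=> [u v|w u|u].
- by rewrite mulrDr; apply: KD.
- by rewrite mulrCA; apply: KM.
- by rewrite mulrCA; apply: Ks.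
Qed.

Lemma products_in_sub r (K K' : R -> Prop) :
  (forall v, K v -> K' v) -> products_in P r K -> products_in P r K'.
Proof.
elim: r K K' => [|i r IHr] K K' sKK'; first exact: sKK'.
by move=> KP p Pp; apply: IHr (KP p Pp) => v; apply: sKK'.
Qed.

Hypothesis comaxP :
  forall i j, i != j -> exists p q, [/\ P i p, P j q & s = p + q].

(* Induction on the number of ideals: if [s = p + q] with [p] and [q] in two of
   the ideals, then [p * u] and [q * u] lie in [K] by induction, hence so does
   [s * u]. *)
Lemma comaximal_inter i r K u : uniq (i :: r) -> saturated s K ->
  products_in P (i :: r) K -> (forall j, j \in i :: r -> P j u) -> K u.
Proof.
elim: r i K => [|j r IHr] i K.
  by move=> _ _ + /(_ i (mem_head _ _)) Pu => /(_ u Pu) /=; rewrite mulr1.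
move=> /= /and3P[]; rewrite inE negb_or => /andP[neq_ij i'r] j'r Ur satK KP Pu.
have [p [q [Pp Pq defs]]] := comaxP neq_ij.
have [KD _ Ks] := satK; apply: Ks; rewrite defs mulrDl; apply: KD.
  apply: (IHr j (fun v => K (p * v))) => //=; first by rewrite j'r.
  - exact: saturated_colon.
  - exact: KP.
  - by move=> j' r_j'; apply: Pu; rewrite inE r_j' orbT.
apply: (IHr i (fun v => K (q * v))) => //=; first by rewrite i'r.
- exact: saturated_colon.
- move=> p' Pp'; apply: products_in_sub (KP p' Pp' q Pq) => v.
  by rewrite mulrCA.
- by move=> j' r_j'; apply: Pu; move: r_j'; rewrite !inE => /orP[]->; rewrite ?orbT.
Qed.

End Comaximal.

Lemma saturated_ideal2 (R : comNzRingType) (s a b : R) :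
  saturated s (fun u => exists n, ideal2 a b (s ^+ n * u)).
Proof.
split=> [u v [n Hu] [m Hv]|w u [n Hu]|u [n Hu]].
- exists (n + m)%N; have -> : s ^+ (n + m) * (u + v) =
    s ^+ m * (s ^+ n * u) + s ^+ n * (s ^+ m * v) by rewrite exprD; ring.
  by apply: ideal2D; apply: ideal2M.
- by exists n; rewrite mulrCA; apply: ideal2M.
- by exists n.+1; rewrite exprSr -mulrA.
Qed.

(** * The configuration and the saturation of its two equations *)

Local Notation o4 k := (@Ordinal 4 k isT).
Local Notation o5 k := (@Ordinal 5 k isT).

(* The point [p_i] has grid coordinates (i, i), and [R] is the horizontal ruling
   of index 4. *)
Definition config (ij : 'I_4 * 'I_5) : bool :=
  (ij.1 == ij.2 :> nat) || (ij.2 == 4 :> nat) && (ij.1 < 2)%N.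

Definition config_seq : seq ('I_4 * 'I_5) :=
  [:: (o4 0, o5 0); (o4 1, o5 1); (o4 2, o5 2); (o4 3, o5 3);
      (o4 0, o5 4); (o4 1, o5 4)].

Lemma mem_config_seq ij : (ij \in config_seq) = config ij.
Proof.
by case: ij => [[[|[|[|[|i]]]] hi] [[|[|[|[|[|j]]]]] hj]].
Qed.

Section ConfigSaturation.
Variables (R : comNzRingType) (x0 x1 y0 y1 : R).
Variables (al : 'I_4 -> R) (be : 'I_5 -> R).

Let l i := x0 - al i * x1.
Let n j := y0 - be j * y1.
Let q := x0 * y0 - x1 * y1.

(* On the curve [q = 0] the two coordinates of a point determine each other, so
   that either of the forms [l] and [n] cuts out the point [(al, be)]. *)
Lemma graph_l (a b s p : R) : a * b = 1 ->
  (exists c d, s = c * x0 + d * x1) ->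
  ideal2 (x0 - a * x1) (y0 - b * y1) p -> ideal2 q (x0 - a * x1) (s * p).
Proof.
move=> ab1 [c [d ->]] [e [f ->]]; exists (f * (c + d * b)).
exists (e * (c * x0 + d * x1) - f * (c * b * y1 + d * b * y0)).
rewrite /q; ring: ab1.
Qed.

Lemma graph_n (a b s p : R) : a * b = 1 ->
  (exists c d, s = c * y0 + d * y1) ->
  ideal2 (x0 - a * x1) (y0 - b * y1) p -> ideal2 q (y0 - b * y1) (s * p).
Proof.
move=> ab1 [c [d ->]] [e [f ->]]; exists (e * (c + d * a)).
exists (f * (c * y0 + d * y1) - e * (c * a * x1 + d * a * x0)).
rewrite /q; ring: ab1.
Qed.

Hypothesis al_unit : forall i i' : 'I_4, i != i' -> exists c, c * (al i - al i') = 1.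
Hypothesis be_unit : forall j j' : 'I_5, j != j' -> exists c, c * (be j - be j') = 1.
Hypothesis albe : forall (i : 'I_4) (j : 'I_5), i = j :> nat -> al i * be j = 1.
Hypothesis be4 : be (o5 4) = 0.

(** Up to powers of [s], the ideals of the four diagonal points multiply into [(q, g)], where [g] is
    the product of the four rulings, and those of the two points on [R] multiply into [(y0, g)]. The
    product of all six then lies in [(y0 * q, g)], and comaximality replaces the intersection by
    this product. *)
Lemma config_saturation (s u : R) :
  (exists c d, s = c * x0 + d * x1) -> (exists c d, s = c * y0 + d * y1) ->
  (forall ij, config ij -> ideal2 (l ij.1) (n ij.2) u) ->
  exists N, ideal2 (y0 * q) (l (o4 0) * (l (o4 1) * (n (o5 2) * n (o5 3))))
                   (s ^+ N * u).
Proof.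
move=> sx sy Pu; set g := l _ * _.
apply: (@comaximal_inter _ s _ (fun ij => ideal2 (l ij.1) (n ij.2)) _
  (o4 0, o5 0) (behead config_seq)
  (fun u => exists N, ideal2 (y0 * q) g (s ^+ N * u))) => //.
(* Two distinct parallel rulings span both variables, since
   $\ell_{i'}-\ell_i=(\alpha_i-\alpha_{i'})x_1$; hence [s] splits as required. The same works for
   [n]. *)
- move=> [i j] [i' j']; rewrite xpair_eqE negb_and => /orP[] /=.
    move=> /al_unit[c c1]; case: sx => a [b ->].
    exists (- c * (a * al i' + b) * l i), (a * l i' + c * (a * al i' + b) * l i').
    split; first exact: ideal2_l.
      by apply: ideal2D; apply: ideal2_l.
    transitivity (a * l i' + (a * al i' + b) * (c * (al i - al i')) * x1).
      by rewrite c1 /l; ring.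
    by rewrite /l; ring.
  move=> /be_unit[c c1]; case: sy => a [b ->].
  exists (- c * (a * be j' + b) * n j), (a * n j' + c * (a * be j' + b) * n j').
  split; first exact: ideal2_r.
    by apply: ideal2D; apply: ideal2_r.
  transitivity (a * n j' + (a * be j' + b) * (c * (be j - be j')) * y1).
    by rewrite c1 /n; ring.
  by rewrite /n; ring.
- exact: saturated_ideal2.
(* Six factors [s]: one for each of the four points on [q], and two to supply [n 2] and [n 3] on the
   ruling [y0]. *)
- move=> p0 H0 p1 H1 p2 H2 p3 H3 r0 G0 r1 G1; exists 6%N.
  have n4 : n (o5 4) = y0 by rewrite /n be4 mul0r subr0.
  (* A diagonal point is off [R]: as [al i] inverts [be j], $y_1=\alpha_i(y_0-n_j)$. *)
  have s_n (j : 'I_5) (i : 'I_4) : i = j :> nat -> ideal2 y0 (n j) s.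
    move=> ij; case: sy => c [d ->]; exists (c + d * al i), (- d * al i).
    by rewrite /n; ring: (albe ij).
  have on_q : ideal2 q g (s * p0 * (s * p1 * (s * p2 * (s * p3)))).
    apply: ideal2_mul; first by apply: graph_l H0 => //; apply: albe.
    apply: ideal2_mul; first by apply: graph_l H1 => //; apply: albe.
    apply: ideal2_mul; first by apply: graph_n H2 => //; apply: albe.
    by apply: graph_n H3 => //; apply: albe.
  have on_y0 : ideal2 y0 g (r0 * (r1 * (s * s))).
    move: G0 G1; rewrite /= n4 => /ideal2C G0 /ideal2C G1.
    do 2![apply: ideal2_mul => //].
    by apply: ideal2_mul; [apply: (s_n _ (o4 2)) | apply: (s_n _ (o4 3))].
  have := ideal2C (ideal2_mul (ideal2C on_y0) (ideal2C on_q)).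
  by congr (ideal2 _ _ _); ring.
- by move=> ij ij_r; apply: Pu; rewrite -mem_config_seq.
Qed.

End ConfigSaturation.

(** * Bihomogeneous forms *)

Section CoxRing.
Variable k : fieldType.
Local Notation S := (cox k).
Local Notation x0 := (xvar k 0).
Local Notation x1 := (xvar k 1).
Local Notation y0 := (yvar k 0).
Local Notation y1 := (yvar k 1).
Implicit Types (u v w : S) (d : int * int).

Lemma mbidegD m1 m2 : mbideg (m1 + m2)%MM = mbideg m1 + mbideg m2.
Proof.
by congr (_, _); rewrite /= -PoszD -big_split; congr Posz; apply: eq_bigr => i _;
  rewrite mnmDE.
Qed.

Lemma bihom0 d : bihom d (0 : S).
Proof. by move=> m; rewrite msupp0. Qed.

Lemma bihomD d u v : bihom d u -> bihom d v -> bihom d (u + v).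
Proof.
by move=> hu hv m /msuppD_le; rewrite mem_cat => /orP[/hu|/hv].
Qed.

Lemma bihomN d u : bihom d u -> bihom d (- u).
Proof. by move=> hu m; rewrite (perm_mem (msuppN u)); apply: hu. Qed.

Lemma bihomB d u v : bihom d u -> bihom d v -> bihom d (u - v).
Proof. by move=> hu hv; apply/bihomD/bihomN. Qed.

Lemma bihomZ d c u : bihom d u -> bihom d (c *: u).
Proof. by move=> hu m /msuppZ_le; apply: hu. Qed.

Lemma bihom_sum d (I : Type) (r : seq I) (P : pred I) (F : I -> S) :
  (forall i, P i -> bihom d (F i)) -> bihom d (\sum_(i <- r | P i) F i).
Proof.
move=> hF; elim/big_rec: _ => [|i u Pi hu]; first exact: bihom0.
by apply: bihomD => //; apply: hF.
Qed.

Lemma bihomM d e u v : bihom d u -> bihom e v -> bihom (d + e) (u * v).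
Proof.
move=> hu hv m /msuppM_le /allpairsP[[m1 m2] /= [/hu <- /hv <- ->]].
exact: mbidegD.
Qed.

Lemma bihom_monomial m : bihom (mbideg m) ('X_[m] : S).
Proof. by move=> m'; rewrite msuppX inE => /eqP ->. Qed.

Lemma bihom1 : bihom 0 (1 : S).
Proof.
move=> m; rewrite msupp1 inE => /eqP ->.
by congr (_, _); congr Posz; apply: big1 => i _; rewrite mnm0E.
Qed.

Lemma bihomX d n u : bihom d u -> bihom (d *+ n) (u ^+ n).
Proof.
move=> hu; elim: n => [|n IHn]; first exact: bihom1.
by rewrite exprS mulrS; apply: bihomM.
Qed.

Lemma bihom_xvar i : bihom (1, 0) (xvar k i).
Proof.
move=> m; rewrite msuppX inE => /eqP ->.
congr (_, _); congr Posz.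
  rewrite (bigD1 i) //= big1 ?addn0 ?mnm1E ?eqxx // => j neq_ji.
  by rewrite mnm1E (inj_eq (@lshift_inj _ _)) eq_sym (negPf neq_ji).
by apply: big1 => j _; rewrite mnm1E eq_lrshift.
Qed.

Lemma bihom_yvar i : bihom (0, 1) (yvar k i).
Proof.
move=> m; rewrite msuppX inE => /eqP ->.
congr (_, _); congr Posz; last first.
  rewrite (bigD1 i) //= big1 ?addn0 ?mnm1E ?eqxx // => j neq_ji.
  by rewrite mnm1E (inj_eq (@rshift_inj _ _)) eq_sym (negPf neq_ji).
by apply: big1 => j _; rewrite mnm1E eq_rlshift.
Qed.

Definition lin_x (a : k) : S := x0 - a%:MP * x1.
Definition lin_y (b : k) : S := y0 - b%:MP * y1.

Lemma bihom_lin_x a : bihom (1, 0) (lin_x a).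
Proof.
by rewrite /lin_x mul_mpolyC; apply/bihomB/bihomZ; apply: bihom_xvar.
Qed.

Lemma bihom_lin_y b : bihom (0, 1) (lin_y b).
Proof.
by rewrite /lin_y mul_mpolyC; apply/bihomB/bihomZ; apply: bihom_yvar.
Qed.

Lemma meval_xvar (a b : 'rV[k]_2) i : (xvar k i).@[row_mx a b 0] = a 0 i.
Proof. by rewrite /xvar mevalXU row_mxEl. Qed.

Lemma meval_yvar (a b : 'rV[k]_2) i : (yvar k i).@[row_mx a b 0] = b 0 i.
Proof. by rewrite /yvar mevalXU row_mxEr. Qed.

Lemma meval_lin_x (a b : 'rV[k]_2) c :
  (lin_x c).@[row_mx a b 0] = a 0 0 - c * a 0 1.
Proof. by rewrite /lin_x mevalB mevalM mevalC !meval_xvar. Qed.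

Lemma meval_lin_y (a b : 'rV[k]_2) c :
  (lin_y c).@[row_mx a b 0] = b 0 0 - c * b 0 1.
Proof. by rewrite /lin_y mevalB mevalM mevalC !meval_yvar. Qed.

(** Congruence modulo an ideal respects sums and products, so replacing each variable by a congruent
    polynomial changes [u] only by an element of the ideal. *)
Lemma ideal2_comp a b (t : (2 + 2).-tuple S) u :
  (forall i, ideal2 a b ('X_i - tnth t i)) -> ideal2 a b (u - (u \mPo t)).
Proof.
move=> ht; have cM u1 u2 v1 v2 : ideal2 a b (u1 - v1) -> ideal2 a b (u2 - v2) ->
    ideal2 a b (u1 * u2 - v1 * v2).
  move=> h1 h2; have -> : u1 * u2 - v1 * v2 = u2 * (u1 - v1) + v1 * (u2 - v2).
    by ring.
  by apply: ideal2D; apply: ideal2M.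
elim/mpolyind: u => [|c m u _ _ IHu].
  by rewrite raddf0 subr0; apply: ideal2_0.
rewrite raddfD /= comp_mpolyZ opprD addrACA -scalerBr -mul_mpolyC.
apply: ideal2D IHu; apply: ideal2M; rewrite comp_mpolyX mpolyXE_id.
elim/big_ind2: _ => [|u1 v1 u2 v2|i _]; first by rewrite subrr; apply: ideal2_0.
  exact: cM.
elim: (m i) => [|e IHe]; first by rewrite subrr; apply: ideal2_0.
by rewrite !exprS; apply: cM.
Qed.

(** Homogeneous coordinates $(t:1)$; every point of the configuration is taken in this affine
    chart. *)
Definition hrow (t : k) : 'rV[k]_2 := \row_j (if j == 0 then t else 1).

Definition ev (s t : k) : S -> k := meval (row_mx (hrow s) (hrow t) 0).

Lemma hrow0 t : hrow t 0 0 = t. Proof. by rewrite mxE. Qed.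
Lemma hrow1 t : hrow t 0 1 = 1. Proof. by rewrite mxE. Qed.

(** Under $x_0\mapsto s x_1$, $y_0\mapsto t y_1$ each monomial of bidegree (a, b) becomes its value
    at (s, t) times $x_1^a y_1^b$. *)
Lemma bihom_comp (a b : nat) (s t : k) u : bihom (a%:Z, b%:Z) u ->
  u \mPo [tuple row_mx (\row_j (if j == 0 then s%:MP * x1 else x1))
                       (\row_j (if j == 0 then t%:MP * y1 else y1)) 0 i | i < 2 + 2]
  = ev s t u *: (x1 ^+ a * y1 ^+ b).
Proof.
move=> hu; rewrite comp_mpolyEX /ev mevalE scaler_suml; apply: eq_big_seq => m.
move=> /hu dm; rewrite /mbideg !big_ord_recl !big_ord0 !addn0 in dm.
case: dm => <- <-.
rewrite comp_mpolyX -scalerA; congr (_ *: _).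
rewrite [in LHS]big_split_ord [X in X *: _](@big_split_ord _ _ _ 2 2) /=.
rewrite !big_ord_recl !big_ord0 /= !tnth_mktuple.
rewrite !row_mxEl !row_mxEr !mxE /= !expr1n !mulr1 -mul_mpolyC.
by rewrite rmorphM !rmorphXn /= !exprD !exprMn; ring.
Qed.

Lemma vanishing_ideal2 (a b : nat) (s t : k) u :
  bihom (a%:Z, b%:Z) u -> ev s t u = 0 -> ideal2 (lin_x s) (lin_y t) u.
Proof.
move=> hu u0; have := @ideal2_comp (lin_x s) (lin_y t)
  [tuple row_mx (\row_j (if j == 0 then s%:MP * x1 else x1))
                (\row_j (if j == 0 then t%:MP * y1 else y1)) 0 i | i < 2 + 2] u.
rewrite (bihom_comp _ _ hu) u0 scale0r subr0; apply=> i; rewrite tnth_mktuple.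
case: (split_ordP i) => j ->; rewrite ?row_mxEl ?row_mxEr mxE.
  case: j => [[|[|//]] hj] /=.
    have -> : 'X_(lshift 2 (Ordinal hj)) = x0.
      by congr 'X_(lshift _ _); apply: val_inj.
    by rewrite -[_ - _]mul1r; apply: ideal2_l.
  have -> : 'X_(lshift 2 (Ordinal hj)) = x1.
    by congr 'X_(lshift _ _); apply: val_inj.
  by rewrite subrr; apply: ideal2_0.
case: j => [[|[|//]] hj] /=.
  have -> : 'X_(rshift 2 (Ordinal hj)) = y0.
    by congr 'X_(rshift _ _); apply: val_inj.
  by rewrite -[_ - _]mul1r; apply: ideal2_r.
have -> : 'X_(rshift 2 (Ordinal hj)) = y1.
  by congr 'X_(rshift _ _); apply: val_inj.
by rewrite subrr; apply: ideal2_0.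
Qed.

End CoxRing.

Section Forms.
Variable k : fieldType.
Local Notation S := (cox k).
Local Notation x0 := (xvar k 0).
Local Notation x1 := (xvar k 1).
Local Notation y0 := (yvar k 0).
Local Notation y1 := (yvar k 1).

Lemma bihom_nat d (u : S) : u != 0 -> bihom d u -> exists a b : nat, d = (a%:Z, b%:Z).
Proof.
by move=> u0 /(_ _ (mlead_supp u0)) <-; do 2!eexists.
Qed.

(** Each monomial is divisible by one of the two variables [z i] of bidegree [e]; stated for an
    arbitrary pair to serve both blocks of variables. *)
Lemma bihom_split_var (z : 'I_2 -> 'I_(2 + 2)) e d (u : S) :
  (forall i, mbideg U_(z i)%MM = e) ->
  (forall m, mbideg m = d + e -> exists i, m (z i) != 0%N) ->
  bihom (d + e) u ->
  exists v w, [/\ bihom d v, bihom d w & u = 'X_(z 0) * v + 'X_(z 1) * w].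
Proof.
move=> ze de hu; rewrite [u]mpolyE big_seq.
elim/big_rec: _ => [|m u' /hu dm [v [w [hv hw ->]]]].
  by exists 0, 0; rewrite !mulr0 addr0; split=> //; apply: bihom0.
have [i mi] := de m dm; pose X := u@_m *: 'X_[(m - U_(z i))%MM] : S.
have hX : bihom d X.
  apply: bihomZ => m'; rewrite msuppX inE => /eqP ->.
  by apply: (addIr e); rewrite -dm -(ze i) -mbidegD submK // lep1mP.
have -> : u@_m *: 'X_[m] = 'X_(z i) * X.
  by rewrite -scalerAr -mpolyXD addmC submK // lep1mP.
case: i mi @X hX => [[|[|//]] hi] mi X hX.
  have -> : Ordinal hi = 0 by apply: val_inj.
  by exists (X + v), w; split; rewrite ?mulrDr ?addrA //; apply: bihomD.
have -> : Ordinal hi = 1 by apply: val_inj.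
by exists v, (X + w); split; rewrite ?mulrDr 1?addrCA //; apply: bihomD.
Qed.

Lemma mbideg_xvar i : mbideg U_(lshift 2 i)%MM = (1, 0).
Proof. by apply: (@bihom_xvar k i); rewrite msuppX inE. Qed.

Lemma mbideg_yvar i : mbideg U_(rshift 2 i)%MM = (0, 1).
Proof. by apply: (@bihom_yvar k i); rewrite msuppX inE. Qed.

Lemma bihom_split_x (a b : nat) (u : S) : bihom (a.+1%:Z, b%:Z) u ->
  exists v w, [/\ bihom (a%:Z, b%:Z) v, bihom (a%:Z, b%:Z) w & u = x0 * v + x1 * w].
Proof.
have -> : (a.+1%:Z, b%:Z) = (a%:Z, b%:Z) + (1, 0) :> (int * int)%type.
  by congr (_, _); rewrite ?addr0 // -addn1 PoszD.
apply: bihom_split_var => [|m]; first exact: mbideg_xvar.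
rewrite /mbideg big_ord_recl big_ord1 => -[m1 _].
have : (0 < m (lshift 2 ord0) + m (lshift 2 (lift ord0 ord0)))%N by lia.
by rewrite addn_gt0 !lt0n => /orP[]; eexists; eassumption.
Qed.

Lemma bihom_split_y (a b : nat) (u : S) : bihom (a%:Z, b.+1%:Z) u ->
  exists v w, [/\ bihom (a%:Z, b%:Z) v, bihom (a%:Z, b%:Z) w & u = y0 * v + y1 * w].
Proof.
have -> : (a%:Z, b.+1%:Z) = (a%:Z, b%:Z) + (0, 1) :> (int * int)%type.
  by congr (_, _); rewrite ?addr0 // -addn1 PoszD.
apply: bihom_split_var => [|m]; first exact: mbideg_yvar.
rewrite /mbideg big_ord_recl [X in (_, X%:Z)]big_ord_recl big_ord1 => -[_ m1].
have : (0 < m (rshift 2 ord0) + m (rshift 2 (lift ord0 ord0)))%N.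
  by move: m1; rewrite big_ord1; lia.
by rewrite addn_gt0 !lt0n => /orP[]; eexists; eassumption.
Qed.

End Forms.

(** * Points *)

Lemma fset_enum_bij (n : nat) (K : choiceType) (f : 'I_n -> K) (X : {fset K}) :
  injective f -> (forall x, x \in X <-> exists i, x = f i) ->
  exists h : 'I_n -> X, bijective h /\ forall i, val (h i) = f i.
Proof.
move=> f_inj memX; have fX i : f i \in X by apply/memX; exists i.
have [/= g gP] : {g : X -> 'I_n & forall x, f (g x) = val x}.
  have ex_i (x : X) : exists i, val x == f i.
    by have /memX[i ->] := valP x; exists i.
  by exists (fun x => xchoose (ex_i x)) => x; rewrite -(eqP (xchooseP (ex_i x))).
exists (fun i => FSetSub (fX i)); split=> //.
exists g => [i|x]; last exact/val_inj/gP.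
by apply: f_inj; rewrite gP.
Qed.

(** * The six points in coordinates *)

Section Grid.
Variable k : fieldType.

Lemma hrow_neq0 (t : k) : hrow t != 0.
Proof. by apply/eqP => /rowP/(_ 1) /eqP; rewrite hrow1 mxE oner_eq0. Qed.

Lemma dim_hrow (t : k) : \dim <[hrow t]>%VS == 1%N.
Proof. by rewrite dim_vline hrow_neq0. Qed.

Definition affine_pt (t : k) : P1 k := exist _ <[hrow t]>%VS (dim_hrow t).

Lemma affine_pt_inj : injective affine_pt.
Proof.
move=> s t /(congr1 val) /= eq_st.
have: hrow s \in <[hrow t]>%VS by rewrite -eq_st memv_line.
case/vlineP=> c /rowP eq_c; have := eq_c 1; have := eq_c 0.
by rewrite !mxE /= mulr1 => -> <-; rewrite mul1r.
Qed.

Definition grid (al : 'I_4 -> k) (be : 'I_5 -> k) : {fset P1 k * P1 k} :=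
  [fset (affine_pt (al ij.1), affine_pt (be ij.2)) | ij in config_seq]%fset.

Lemma mem_grid al be i j : injective al -> injective be ->
  ((affine_pt (al i), affine_pt (be j)) \in grid al be) = config (i, j).
Proof.
move=> al_inj be_inj; rewrite -mem_config_seq; apply/imfsetP/idP => /= [[[i' j']]|].
  move=> + e; have /affine_pt_inj/al_inj -> := congr1 fst e.
  by have /affine_pt_inj/be_inj -> := congr1 snd e.
by move=> ij; exists (i, j).
Qed.

Lemma mem_pi1_grid al be x :
  x \in pi1 (grid al be) <-> exists i, x = affine_pt (al i).
Proof.
split=> [/imfsetP[p /imfsetP[ij _ ->] ->]|[i ->]]; first by exists ij.1.
have [j ij] : exists j, (i, j) \in config_seq.
  exists (widen_ord (leqnSn 4) i); rewrite mem_config_seq /config /=.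
  by rewrite eqxx.
by apply/imfsetP; exists (affine_pt (al i), affine_pt (be j)) => //;
  apply/imfsetP; exists (i, j).
Qed.

Lemma mem_pi2_grid al be x :
  x \in pi2 (grid al be) <-> exists j, x = affine_pt (be j).
Proof.
split=> [/imfsetP[p /imfsetP[ij _ ->] ->]|[j ->]]; first by exists ij.2.
have [i ij] : exists i, (i, j) \in config_seq.
  (* The index modulo 4 gives the diagonal point for [j < 4], and the point of column 0 for the
     ruling [R] of index 4. *)
  exists (inord (j %% 4)); rewrite mem_config_seq.
  by case: j => [[|[|[|[|[|j]]]]] hj] //; rewrite /config /= inordK.
by apply/imfsetP; exists (affine_pt (al i), affine_pt (be j)) => //;
  apply/imfsetP; exists (i, j).
Qed.

(** Both sets of rulings are enumerated by the same indices, and membership in either grid is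
    [config] of the indices. *)
Lemma grid_equiv al be al' be' :
  injective al -> injective be -> injective al' -> injective be' ->
  equiv_config (grid al be) (grid al' be').
Proof.
move=> al_inj be_inj al'_inj be'_inj.
have [h [[g hK gK] hE]] := fset_enum_bij (inj_comp affine_pt_inj al_inj)
  (mem_pi1_grid al be).
have [h' [[g' hK' gK'] hE']] := fset_enum_bij (inj_comp affine_pt_inj al'_inj)
  (mem_pi1_grid al' be').
have [e [[d eK dK] eE]] := fset_enum_bij (inj_comp affine_pt_inj be_inj)
  (mem_pi2_grid al be).
have [e' [[d' eK' dK'] eE']] := fset_enum_bij (inj_comp affine_pt_inj be'_inj)
  (mem_pi2_grid al' be').
exists (h' \o g), (e' \o d); split=> [||a b].
- by exists (h \o g') => x /=; rewrite ?hK' ?gK ?hK ?gK'.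
- by exists (e \o d') => x /=; rewrite ?eK' ?dK ?eK ?dK'.
- by rewrite /= hE' eE' -{1}[a]gK -{1}[b]dK hE eE !mem_grid.
Qed.

Lemma vanishing_gridP al be (u : cox k) :
  vanishing_ideal (grid al be) u <->
  forall i j c d, config (i, j) -> c != 0 -> d != 0 ->
    u.@[row_mx (c *: hrow (al i)) (d *: hrow (be j)) 0] = 0.
Proof.
split=> [Xu i j c d ij c0 d0|u0 p a b /imfsetP[[i j]]].
  apply: (Xu (affine_pt (al i), affine_pt (be j))); rewrite ?scaler_eq0 ?negb_or.
  - by apply/imfsetP; exists (i, j); rewrite //= mem_config_seq.
  - by apply/vlineP; exists c.
  - by rewrite c0 hrow_neq0.
  - by apply/vlineP; exists d.
  - by rewrite d0 hrow_neq0.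
rewrite /= mem_config_seq => ij -> /= /vlineP[c ->] c0 /vlineP[d ->] d0.
apply: u0 => //; first by move: c0; rewrite scaler_eq0 negb_or => /andP[].
by move: d0; rewrite scaler_eq0 negb_or => /andP[].
Qed.

Lemma vanishing_grid_ev al be u i j :
  vanishing_ideal (grid al be) u -> config (i, j) -> ev (al i) (be j) u = 0.
Proof.
move=> /vanishing_gridP u0 /(u0 _ _ 1 1).
by rewrite !scale1r /ev => -> //; rewrite oner_eq0.
Qed.

End Grid.

(** Euclid's argument: no element of [0 :: s] is a root of $1+\prod(X-a)$, so a root of it is a new
    nonzero scalar. *)
Lemma closedField_uniq (k : closedFieldType) n :
  exists s : seq k, [/\ uniq s, size s = n & 0 \notin s].
Proof.
elim: n => [|n [s [s_uniq <- s0]]]; first by exists [::].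
have /closed_rootP[x] : size (1 + \prod_(a <- 0 :: s) ('X - a%:P)) != 1%N.
  by rewrite addrC size_polyDl ?size_prod_XsubC // size_poly1.
rewrite rootE hornerD hornerC horner_prod => x_root.
exists (x :: s); have: x \notin 0 :: s.
  apply: contraL x_root => xs; rewrite (big_rem x xs) /= hornerXsubC subrr mul0r.
  by rewrite addr0 oner_eq0.
rewrite inE negb_or eq_sym => /andP[x0 xs].
by split=> //=; [rewrite xs | rewrite inE negb_or x0].
Qed.

(** * Sheaves of cyclic modules *)

Section CyclicSheaf.
Variable k : fieldType.
Local Notation S := (cox k).

Definition cyclic_mod (A : 'rV[S]_1 -> Prop) : bimod k :=
  @Bimod k 1 (fun=> 0) A.

Definition submodule (A : 'rV[S]_1 -> Prop) : Prop :=
  [/\ A 0, forall u v, A u -> A v -> A (u + v) & forall c u, A u -> A (c *: u)].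

(** The vectors that lie in [A] after inverting [s]. *)
Definition loc (A : 'rV[S]_1 -> Prop) (s : S) (v : 'rV[S]_1) : Prop :=
  exists n, A (s ^+ n *: v).

Section Loc.
Variables (A : 'rV[S]_1 -> Prop) (s : S).
Hypothesis subA : submodule A.

Lemma loc0 : loc A s 0.
Proof. by case: subA => A0 _ _; exists 0%N; rewrite scaler0. Qed.

Lemma locZ c u : loc A s u -> loc A s (c *: u).
Proof.
by case: subA => _ _ AZ [n Au]; exists n; rewrite scalerA mulrC -scalerA; apply: AZ.
Qed.

Lemma locD u v : loc A s u -> loc A s v -> loc A s (u + v).
Proof.
case: subA => _ AD AZ [n Au] [m Av]; exists (n + m)%N.
rewrite scalerDr {1}exprD mulrC exprD -!scalerA.
by apply: AD; apply: AZ.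
Qed.

Lemma locB u v : loc A s u -> loc A s v -> loc A s (u - v).
Proof. by move=> Au /(locZ (-1)); rewrite scaleN1r; apply: locD. Qed.

Lemma loc_pow n u : loc A s (s ^+ n *: u) -> loc A s u.
Proof. by case=> m Au; exists (m + n)%N; rewrite exprD -scalerA. Qed.

Lemma sect_eq_refl (u : Defs.frac (cyclic_mod A)) : sect_eq s u u.
Proof. by rewrite /sect_eq subrr; apply: loc0. Qed.

Lemma sect_eq_sym (u v : Defs.frac (cyclic_mod A)) : sect_eq s u v -> sect_eq s v u.
Proof. by move=> /(locZ (-1)); rewrite scaleN1r opprB. Qed.

Lemma sect_eq_trans (v u w : Defs.frac (cyclic_mod A)) :
  sect_eq s u v -> sect_eq s v w -> sect_eq s u w.
Proof.
move=> uv vw; apply: (@loc_pow v.1).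
have -> : s ^+ v.1 *: (s ^+ w.1 *: u.2 - s ^+ u.1 *: w.2) =
    s ^+ w.1 *: (s ^+ v.1 *: u.2 - s ^+ u.1 *: v.2) +
    s ^+ u.1 *: (s ^+ w.1 *: v.2 - s ^+ v.1 *: w.2).
  rewrite !scalerBr !scalerA addrA [s ^+ u.1 * s ^+ w.1]mulrC subrK.
  by rewrite [s ^+ v.1 * s ^+ w.1]mulrC [s ^+ v.1 * s ^+ u.1]mulrC.
by apply: locD; apply: locZ.
Qed.

End Loc.

(** The identity on fractions works in both directions: equality of two sections is a relation on a
    bihomogeneous numerator, and the two localizations contain the same ones. *)
Lemma cyclic_sheaf_iso (A B : 'rV[S]_1 -> Prop) :
  submodule A -> submodule B ->
  (forall s e d (v : 'rV[S]_1), dopen s e -> bihom d (v 0 0) -> A v -> loc B s v) ->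
  (forall s e d (v : 'rV[S]_1), dopen s e -> bihom d (v 0 0) -> B v -> loc A s v) ->
  sheaf_iso (cyclic_mod A) (cyclic_mod B).
Proof.
have idP A1 B1 : submodule A1 -> submodule B1 ->
    (forall s e d (v : 'rV[S]_1),
       dopen s e -> bihom d (v 0 0) -> A1 v -> loc B1 s v) ->
    @sheaf_mor k (cyclic_mod A1) (cyclic_mod B1) (fun _ _ u => u).
  move=> subA subB AB; split=> [//|s e u v [hs e1 e2] Hu Hv [n A_n]|||].
  - apply: (@loc_pow _ _ n); apply: (AB _ e (e *+ (n + v.1 + u.1))) A_n => //.
    rewrite !mxE; move: (Hu 0) (Hv 0); rewrite !subr0 => hu hv.
    rewrite -addnA !mulrnDr; apply: bihomM; first exact: bihomX.
    apply: bihomB; first by apply: bihomM => //; apply: bihomX.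
    by rewrite addrC; apply: bihomM => //; apply: bihomX.
  - by move=> s e u v _ _ _; apply: (@sect_eq_refl B1).
  - by move=> s e a u _ _ _; apply: (@sect_eq_refl B1).
  - by move=> s e t d u _ _ _ _; apply: (@sect_eq_refl B1).
move=> subA subB AB BA.
exists (fun _ _ u => u), (fun _ _ u => u); split; try exact: idP.
  by move=> s e u _ _; apply: (@sect_eq_refl A).
by move=> s e u _ _; apply: (@sect_eq_refl B).
Qed.

(** An isomorphism need not fix the section 1, but it preserves annihilators: if [v] kills 1 on the
    side of [A], it kills [h], the numerator of [phi 1], and 1 on the side of [B] is a multiple of
    [phi 1]. *)
Lemma sheaf_iso_loc (A B : 'rV[S]_1 -> Prop) s e n (v : 'rV[S]_1) :
  submodule A -> submodule B -> sheaf_iso (cyclic_mod A) (cyclic_mod B) ->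
  dopen s e -> bihom (e *+ n) (v 0 0) -> A v -> loc B s v.
Proof.
move=> subA subB [phi [psi [phiP psiP _ phiK]]] se hv Av.
pose one : nat * 'rV[S]_1 := (0%N, const_mx 1).
have one_sect : @is_sect k (cyclic_mod A) e one.
  by move=> j; rewrite subr0 mxE; apply: bihom1.
have one_sect' : @is_sect k (cyclic_mod B) e one by [].
have scale_one (a : nat * S) : bihom (e *+ a.1) a.2 ->
    @sect_eq k (cyclic_mod B) s (phi s e (a.1, a.2 *: const_mx 1))
      ((a.1 + (phi s e one).1)%N, a.2 *: (phi s e one).2).
  move=> ha; have := mor_scale phiP se ha one_sect.
  by rewrite /sect_scale /= addn0.
have rowE (w : 'rV[S]_1) : w = w 0 0 *: const_mx 1.
  by apply/rowP => i; rewrite !mxE mulr1 ord1.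
set h := (phi s e one).2 in scale_one.
set m := (phi s e one).1 in scale_one.
have loc_ah : loc B s (v 0 0 *: h).
  have zero_sect : @is_sect k (cyclic_mod A) e (0%N, 0 *: const_mx 1).
    by move=> j; rewrite scale0r mxE; apply: bihom0.
  have v_sect : @is_sect k (cyclic_mod A) e (n, v 0 0 *: const_mx 1).
    by move=> j; rewrite subr0 !mxE mulr1.
  have v_zero : @sect_eq k (cyclic_mod A) s (n, v 0 0 *: const_mx 1)
      (0%N, 0 *: const_mx 1).
    by exists 0%N; rewrite /= scale0r scaler0 subr0 -rowE !scale1r.
  have phi_v := sect_eq_sym subB (scale_one (n, v 0 0) hv).
  have phi_0 := scale_one (0%N, 0) (@bihom0 _ _).
  have := sect_eq_trans subB phi_v (sect_eq_trans subB
    (mor_eq phiP se v_sect zero_sect v_zero) phi_0).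
  by rewrite /sect_eq /= scale0r scaler0 subr0 => /loc_pow.
(* This is [phi (psi 1) = 1], with [psi 1] written as a coefficient times the generator 1. *)
have loc_hh : loc B s ((psi s e one).2 0 0 *: h -
    s ^+ ((psi s e one).1 + m) *: const_mx 1).
  have psi_sect := mor_sect psiP se one_sect'.
  have hpsi : bihom (e *+ (psi s e one).1) ((psi s e one).2 0 0).
    by have := psi_sect 0; rewrite subr0.
  have := sect_eq_trans subB (sect_eq_sym subB (scale_one (_, _) hpsi)).
  move=> /(_ one); rewrite -rowE -surjective_pairing.
  move=> /(_ (phiK s e one se one_sect')).
  by rewrite /sect_eq /= scale1r.
apply: (@loc_pow _ _ ((psi s e one).1 + m)).
have -> : s ^+ ((psi s e one).1 + m) *: v = (psi s e one).2 0 0 *: (v 0 0 *: h) -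
    v 0 0 *: ((psi s e one).2 0 0 *: h - s ^+ ((psi s e one).1 + m) *: const_mx 1).
  rewrite scalerBr !scalerA [_ 0 0 * v 0 0]mulrC subKr.
  by rewrite mulrC -scalerA -rowE.
by apply: locB => //; apply: locZ.
Qed.

End CyclicSheaf.

(** * Points on a curve of bidegree (1, 1) and a ruling *)

Section Koszul.
Variable k : fieldType.
Local Notation S := (cox k).
Local Notation x0 := (xvar k 0).
Local Notation x1 := (xvar k 1).
Local Notation y0 := (yvar k 0).
Local Notation y1 := (yvar k 1).

Lemma sum_I2 (V : nmodType) (F : 'I_2 -> V) : \sum_i F i = F 0 + F 1.
Proof. by rewrite big_ord_recl big_ord1; congr (_ + F _); apply: val_inj. Qed.

Lemma koszul_imageP (f g : S) (v : 'rV[S]_1) :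
  (exists w : 'rV[S]_2, v = w *m koszul_diff f g 0) <-> ideal2 f g (v 0 0).
Proof.
split=> [[w ->]|[c [d vE]]].
  by exists (w 0 0), (w 0 1); rewrite !mxE sum_I2 !mxE.
exists (\row_j (if j == 0 then c else d)); apply/rowP => j; rewrite ord1 vE.
by rewrite !mxE sum_I2 !mxE.
Qed.

Lemma koszul_submodule (f g : S) :
  submodule (fun v : 'rV[S]_1 => exists w : 'rV[S]_2, v = w *m koszul_diff f g 0).
Proof.
split=> /=.
- by apply/koszul_imageP; rewrite mxE; apply: ideal2_0.
- move=> u v /koszul_imageP hu /koszul_imageP hv.
  by apply/koszul_imageP; rewrite mxE; apply: ideal2D.
- move=> c u /koszul_imageP hu.
  by apply/koszul_imageP; rewrite mxE; apply: ideal2M.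
Qed.

Lemma vanishing_submodule (X : {fset P1 k * P1 k}) :
  submodule (fun v : 'rV[S]_1 => vanishing_ideal X (v 0 0)).
Proof.
split=> [p a b *|u v hu hv p a b *|c u hu p a b *]; rewrite mxE.
- by rewrite meval0.
- by rewrite mevalD (hu p) ?(hv p) ?addr0.
- by rewrite mevalM (hu p) ?mulr0.
Qed.

(* When [l] is prime, this says that [l] does not divide [f]. *)
Definition cancelable (f l : S) : Prop :=
  l != 0 /\ forall v w, v * f = l * w -> exists v', v = v' * l.

Lemma cancelableM f l m :
  cancelable f l -> cancelable f m -> cancelable f (l * m).
Proof.
move=> [l0 lf] [m0 mf]; split=> [|v w]; first by rewrite mulf_neq0.
rewrite -mulrA => /[dup] /lf[v' ->] vlf.
have /mf[v'' ->] : v' * f = m * w by apply: (mulfI l0); rewrite -vlf; ring.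
by exists v''; rewrite [l * m]mulrC mulrA.
Qed.

Lemma comp_mpoly_var (t : (2 + 2).-tuple S) i : 'X_i \mPo t = tnth t i.
Proof. by rewrite comp_mpolyXU -tnth_nth. Qed.

(** The substitution [t] has kernel [(l)] and values in a domain: if [l] divides [v * f] and [f]
    survives [t], then [v] is killed by [t]. The second generator 0 makes [ideal2] principal. *)
Lemma cancelable_subst (t : (2 + 2).-tuple S) (f l : S) :
  (forall i, ideal2 l 0 ('X_i - tnth t i)) -> l \mPo t = 0 -> l != 0 ->
  f \mPo t != 0 -> cancelable f l.
Proof.
move=> ht lt l0 ft; split=> // v w /(congr1 (comp_mpoly t)).
rewrite !rmorphM /= lt mul0r => /eqP; rewrite mulf_eq0 (negPf ft) orbF => /eqP vt.
by have [c [d]] := ideal2_comp v ht; rewrite vt subr0 mulr0 addr0 => ->; exists c.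
Qed.

(** The ruling [R], placed at $y_0=0$, together with the curve on which the two affine coordinates
    are inverse to each other. *)
Definition diag_f : S := y0 * (x0 * y0 - x1 * y1).

Lemma cancelable_lin_x (a : k) : cancelable diag_f (lin_x a).
Proof.
pose t := [tuple row_mx (\row_j (if j == 0 then a%:MP * x1 else x1))
                        (\row_j yvar k j) 0 i | i < 2 + 2].
have tl i : tnth t (lshift 2 i) = if i == 0 then a%:MP * x1 else x1.
  by rewrite tnth_mktuple row_mxEl mxE.
have tr i : tnth t (rshift 2 i) = yvar k i by rewrite tnth_mktuple row_mxEr mxE.
apply: (@cancelable_subst t) => [i|||].
- case: (split_ordP i) => j ->; last first.
    by rewrite tr subrr; apply: ideal2_0.
  rewrite tl; case: ifP => [/eqP ->|j0].
    by rewrite -[_ - _]mul1r; apply: ideal2_l.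
  suff -> : j = 1 by rewrite subrr; apply: ideal2_0.
  by case: j j0 => [[|[|//]] hj] // _; apply: val_inj.
- rewrite /lin_x raddfB /= rmorphM /= comp_mpolyC !comp_mpoly_var !tl /=.
  by rewrite subrr.
- apply: contraNneq (oner_neq0 k) => /(congr1 (meval (row_mx (hrow (a + 1)) 0 0))).
  by rewrite meval_lin_x ?meval0 hrow0 hrow1 mulr1 addrAC subrr add0r => ->.
- rewrite /diag_f !(rmorphM, rmorphB) /= !comp_mpoly_var !tl !tr /=.
  (* At $x=(0,1)$, $y=(1,a+1)$ the substituted form $y_0(a x_1y_0-x_1y_1)$ takes the value $-1$. *)
  apply: contraNneq (oner_neq0 k).
  move/(congr1 (meval (row_mx (hrow 0) (\row_j (if j == 0 then 1 else a + 1)) 0))).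
  rewrite !(mevalM, mevalB, mevalC) !meval_xvar !meval_yvar !mxE /= ?meval0.
  rewrite !mulr1 !mul1r opprD addrA subrr add0r => /eqP.
  by rewrite oppr_eq0 => /eqP ->.
Qed.

Lemma cancelable_lin_y (b : k) : b != 0 -> cancelable diag_f (lin_y b).
Proof.
move=> b0; pose t := [tuple row_mx (\row_j xvar k j)
  (\row_j (if j == 0 then b%:MP * y1 else y1)) 0 i | i < 2 + 2].
have tl i : tnth t (lshift 2 i) = xvar k i by rewrite tnth_mktuple row_mxEl mxE.
have tr i : tnth t (rshift 2 i) = if i == 0 then b%:MP * y1 else y1.
  by rewrite tnth_mktuple row_mxEr mxE.
apply: (@cancelable_subst t) => [i|||].
- case: (split_ordP i) => j ->; first by rewrite tl subrr; apply: ideal2_0.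
  rewrite tr; case: ifP => [/eqP ->|j0].
    by rewrite -[_ - _]mul1r; apply: ideal2_l.
  suff -> : j = 1 by rewrite subrr; apply: ideal2_0.
  by case: j j0 => [[|[|//]] hj] // _; apply: val_inj.
- rewrite /lin_y raddfB /= rmorphM /= comp_mpolyC !comp_mpoly_var !tr /=.
  by rewrite subrr.
- apply: contraNneq (oner_neq0 k) => /(congr1 (meval (row_mx 0 (hrow (b + 1)) 0))).
  by rewrite meval_lin_y ?meval0 hrow0 hrow1 mulr1 addrAC subrr add0r => ->.
- rewrite /diag_f !(rmorphM, rmorphB) /= !comp_mpoly_var !tl !tr /=.
  (* At $x=(1,b+1)$, $y=(0,1)$ the substituted form $b y_1(b x_0y_1-x_1y_1)$ takes the value
     $-b$. *)
  apply: contraNneq b0.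
  move/(congr1 (meval (row_mx (\row_j (if j == 0 then 1 else b + 1)) (hrow 0) 0))).
  rewrite !(mevalM, mevalB, mevalC) !meval_xvar !meval_yvar !mxE /= ?meval0.
  rewrite !mulr1 !mul1r opprD addrA subrr add0r mulrN1 => /eqP.
  by rewrite oppr_eq0 => /eqP ->.
Qed.

(** The hypotheses make [f], [g] a regular sequence, so the higher homology vanishes and every [h]
    annihilates it. *)
Lemma koszul_exact df dg (f g : S) (hf : bihom df f) (hg : bihom dg g) i h :
  f != 0 -> cancelable f g -> ann_homology (koszul hf hg) i h.
Proof.
(* Index [i] refers to homology in degree [i.+1]; the cases are degrees 1, 2 and at least 3. *)
move=> f0 [g0 fg]; case: i => [|[|i]] v /=.
- move=> /rowP/(_ 0); rewrite mxE sum_I2 !mxE /= => vfg.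
  have /fg[w v0] : v 0 0 * f = g * - v 0 1.
    by apply/eqP; rewrite mulrN -subr_eq0 opprK [g * _]mulrC; apply/eqP.
  have v1 : v 0 1 = - (w * f).
    apply: (mulIf g0); apply/eqP; rewrite -subr_eq0 mulNr opprK addrC.
    by rewrite mulrAC -v0; apply/eqP.
  exists (\row_j - (h * w)); apply/rowP => j; rewrite !mxE big_ord1 !mxE.
  case: j => [[|[|//]] hj] /=.
    have -> : Ordinal hj = 0 by apply: val_inj.
    by rewrite v0 mulrNN mulrA.
  have -> : Ordinal hj = 1 by apply: val_inj.
  by rewrite v1; ring.
- move=> /rowP/(_ 1); rewrite mxE big_ord1 !mxE /= => /eqP.
  rewrite mulf_eq0 (negPf f0) orbF => /eqP v0; exists 0.
  by rewrite mul0mx; apply/rowP => j; rewrite !mxE ord1 v0 mulr0.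
- by move=> _; exists 0; apply/rowP => -[].
Qed.

End Koszul.

Lemma VCI_grid (k : fieldType) (al : 'I_4 -> k) (be : 'I_5 -> k) :
  injective al -> injective be ->
  (forall (i : 'I_4) (j : 'I_5), i = j :> nat -> al i * be j = 1) ->
  be (o5 4) = 0 -> VCI (grid al be).
Proof.
move=> al_inj be_inj albe be4.
have be0 j : j != o5 4 -> be j != 0.
  by apply: contraNneq => bj; apply/eqP/be_inj; rewrite bj be4.
(* Vertical rulings through $p_0,p_1$, which also meet [R] in the two extra points, and horizontal
   rulings through $p_2,p_3$. *)
pose g := lin_x (al (o4 0)) * (lin_x (al (o4 1)) *
  (lin_y (be (o5 2)) * lin_y (be (o5 3)))).
have hf : bihom ((0, 1) + ((1, 0) + (0, 1))) (diag_f k).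
  apply: bihomM; first exact: bihom_yvar.
  apply: bihomB.
    by apply: bihomM; [apply: bihom_xvar | apply: bihom_yvar].
  by apply: bihomM; [apply: bihom_xvar | apply: bihom_yvar].
have hg : bihom ((1, 0) + ((1, 0) + ((0, 1) + (0, 1)))) g.
  do 2![apply: bihomM; first exact: bihom_lin_x].
  by apply: bihomM; apply: bihom_lin_y.
have fg : cancelable (diag_f k) g.
  do 2![apply: cancelableM; first exact: cancelable_lin_x].
  by apply: cancelableM; apply: cancelable_lin_y; apply: be0.
have f0 : diag_f k != 0.
  rewrite /diag_f; apply: contraNneq (oner_neq0 k).
  move/(congr1 (meval (row_mx (hrow 0) (hrow 1) 0))).
  rewrite !(mevalM, mevalB) !meval_xvar !meval_yvar !mxE /= ?meval0.
  by rewrite !mulr1 mul1r sub0r => /eqP; rewrite oppr_eq0.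
eexists; eexists; exists (diag_f k), g, hf, hg; split.
  by move=> i; exists 1%N => // h _; apply: koszul_exact.
apply: cyclic_sheaf_iso.
- exact: vanishing_submodule.
- exact: koszul_submodule.
- move=> s e d v [hs e1 e2] hv Xv.
  have [->|v0] := eqVneq v 0; first by apply: loc0; apply: koszul_submodule.
  have v00 : v 0 0 != 0.
    by apply: contraNneq v0 => v0; apply/eqP/rowP => i; rewrite ord1 v0 mxE.
  (* [dopen] admits [s = 0], whose open set is empty; every vector is then in the localization. *)
  have [s0|s_neq0] := eqVneq s 0.
    exists 1%N; rewrite s0 scale0r; apply/koszul_imageP.
    by rewrite mxE; apply: ideal2_0.
  have [a [b def_e]] := bihom_nat s_neq0 hs.
  have [a' [b' def_d]] := bihom_nat v00 hv.
  rewrite {}def_e {}def_d /= in hs hv e1 e2.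
  have sx : exists c d, s = c * xvar k 0 + d * xvar k 1.
    case: a hs e1 => [|a] // /bihom_split_x[c [d' [_ _ ->]]] _.
    by exists c, d'; rewrite ![xvar k _ * _]mulrC.
  have sy : exists c d, s = c * yvar k 0 + d * yvar k 1.
    case: b hs e2 => [|b] // /bihom_split_y[c [d' [_ _ ->]]] _.
    by exists c, d'; rewrite ![yvar k _ * _]mulrC.
  have unitC (c c' : k) : c != c' ->
      exists z : cox k, z * (c%:MP - c'%:MP) = 1.
    move=> neq_c; exists (c - c')^-1%:MP.
    by rewrite -mpolyCB -mpolyCM mulVf ?subr_eq0.
  have [N ideal_v] : exists N, ideal2 (diag_f k) g (s ^+ N * v 0 0).
    apply: (@config_saturation _ _ _ _ _ (fun i => (al i)%:MP) (fun j => (be j)%:MP)).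
    - by move=> i i' neq_i; apply: unitC; rewrite (inj_eq al_inj).
    - by move=> j j' neq_j; apply: unitC; rewrite (inj_eq be_inj).
    - by move=> i j ij; rewrite -mpolyCM albe.
    - by rewrite be4.
    - exact: sx.
    - exact: sy.
    - move=> [i j] ij; apply: (vanishing_ideal2 hv).
      exact: vanishing_grid_ev Xv ij.
  by exists N; apply/koszul_imageP; rewrite mxE.
- move=> s e d v _ _ /koszul_imageP[c [d' vE]]; exists 0%N; rewrite scale1r vE.
  apply/vanishing_gridP => i j c1 d1 ij _ _; rewrite mevalD /g /diag_f.
  rewrite !mevalM mevalB !mevalM !meval_lin_x !meval_lin_y !meval_xvar !meval_yvar.
  rewrite !mxE /=.
  move: ij; rewrite -mem_config_seq !inE.
  have f_zero (i' : 'I_4) (j' : 'I_5) : i' = j' :> nat ->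
      c1 * al i' * (d1 * be j') - c1 * 1 * (d1 * 1) = 0.
    by move=> ij; ring: (albe i' j' ij).
  do 4![case/orP; first by move=> /eqP[-> ->]; rewrite f_zero //; ring].
  by case/orP => /eqP[-> ->]; rewrite be4; ring.
Qed.

(** * Forms vanishing on the configuration *)

Section Coefficients.
Variable k : fieldType.
Local Notation S := (cox k).
Local Notation x0 := (xvar k 0).
Local Notation x1 := (xvar k 1).
Local Notation y0 := (yvar k 0).
Local Notation y1 := (yvar k 1).

Lemma prod_I2 (R : comNzRingType) (F : 'I_2 -> R) : \prod_i F i = F 0 * F 1.
Proof. by rewrite big_ord_recl big_ord1; congr (_ * F _); apply: val_inj. Qed.

Lemma sum_nat_I2 (F : 'I_2 -> nat) : (\sum_i F i = F 0%R + F 1%R)%N.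
Proof. by rewrite big_ord_recl big_ord1; congr (_ + F _)%N; apply: val_inj. Qed.

Lemma mnm4P (m m' : 'X_{1..2 + 2}) :
  m (lshift 2 0) = m' (lshift 2 0) -> m (lshift 2 1) = m' (lshift 2 1) ->
  m (rshift 2 0) = m' (rshift 2 0) -> m (rshift 2 1) = m' (rshift 2 1) -> m = m'.
Proof.
move=> e1 e2 e3 e4; apply/mnmP => i.
have I2P (j : 'I_2) : j = 0 \/ j = 1.
  by case: j => [[|[|//]] hj]; [left | right]; apply: val_inj.
by case: (split_ordP i) => j ->; case: (I2P j) => ->.
Qed.

Definition mon (a b i j : nat) : 'X_{1..2 + 2} :=
  [multinom nth 0%N [:: i; a - i; j; b - j]%N l | l < 2 + 2].

Lemma mpolyX_mon a b i j :
  'X_[mon a b i j] = x0 ^+ i * x1 ^+ (a - i) * (y0 ^+ j * y1 ^+ (b - j)) :> S.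
Proof. by rewrite mpolyXE_id big_split_ord /= !prod_I2 !mnmE. Qed.

Lemma mbideg_mon a b i j : (i <= a)%N -> (j <= b)%N ->
  mbideg (mon a b i j) = (a%:Z, b%:Z).
Proof.
by move=> ia jb; rewrite /mbideg !sum_nat_I2 !mnmE /= !subnKC.
Qed.

Lemma mon_mbideg a b m : mbideg m = (a%:Z, b%:Z) ->
  [/\ (m (lshift 2 0%R) <= a)%N, (m (rshift 2 0%R) <= b)%N &
      m = mon a b (m (lshift 2 0)) (m (rshift 2 0))].
Proof.
rewrite /mbideg !sum_nat_I2 => -[<- <-]; rewrite !leq_addr; split=> //.
by apply: mnm4P; rewrite mnmE //= addKn.
Qed.

Variables a b : nat.

(** Coefficient matrices make the forms of one bidegree a vector space of known dimension. *)
Definition form_of (A : 'M[k]_(a.+1, b.+1)) : S :=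
  \sum_(i < a.+1) \sum_(j < b.+1) A i j *: 'X_[mon a b i j].

Definition mx_of (u : S) : 'M[k]_(a.+1, b.+1) := \matrix_(i, j) u@_(mon a b i j).

Lemma form_of_is_linear : linear form_of.
Proof.
move=> c A B; rewrite /form_of scaler_sumr -big_split; apply: eq_bigr => i _ /=.
rewrite scaler_sumr -big_split; apply: eq_bigr => j _ /=.
by rewrite !mxE scalerDl scalerA.
Qed.
HB.instance Definition _ := GRing.isLinear.Build _ _ _ _ form_of form_of_is_linear.

Lemma mx_of_is_linear : linear mx_of.
Proof.
by move=> c u v; apply/matrixP => i j; rewrite !mxE mcoeffD mcoeffZ.
Qed.
HB.instance Definition _ := GRing.isLinear.Build _ _ _ _ mx_of mx_of_is_linear.

Lemma bihom_form_of A : bihom (a%:Z, b%:Z) (form_of A).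
Proof.
apply: bihom_sum => i _; apply: bihom_sum => j _; apply: bihomZ.
have <- := @mbideg_mon a b i j (ltn_ord i) (ltn_ord j); exact: bihom_monomial.
Qed.

Lemma mcoeff_form_of A (i : 'I_a.+1) (j : 'I_b.+1) :
  (form_of A)@_(mon a b i j) = A i j.
Proof.
rewrite raddf_sum /= (bigD1 i) //= [X in _ + X]big1 => [|i' neq_i].
  rewrite addr0 raddf_sum /= (bigD1 j) //= [X in _ + X]big1 => [|j' neq_j].
    by rewrite mcoeffZ mcoeffX eqxx mulr1 addr0.
  rewrite mcoeffZ mcoeffX; case: eqP => [/mnmP/(_ (rshift 2 0))|_].
    by rewrite !mnmE /= => /val_inj eq_j; rewrite eq_j eqxx in neq_j.
  by rewrite mulr0.
rewrite raddf_sum /= big1 // => j' _; rewrite mcoeffZ mcoeffX.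
case: eqP => [/mnmP/(_ (lshift 2 0))|_]; last by rewrite mulr0.
by rewrite !mnmE /= => /val_inj eq_i; rewrite eq_i eqxx in neq_i.
Qed.

Lemma form_ofK : cancel form_of mx_of.
Proof. by move=> A; apply/matrixP => i j; rewrite mxE mcoeff_form_of. Qed.

Lemma mx_ofK u : bihom (a%:Z, b%:Z) u -> form_of (mx_of u) = u.
Proof.
move=> hu; apply/mpolyP => m.
have [dm|ndm] := eqVneq (mbideg m) (a%:Z, b%:Z).
  have [ia jb ->] := mon_mbideg dm; 
  have := mcoeff_form_of (mx_of u) (Ordinal (ia : _ < a.+1)%N).
  by move=> /(_ (Ordinal (jb : _ < b.+1)%N)) ->; rewrite mxE.
rewrite !memN_msupp_eq0 //; first by apply: contra ndm => /hu ->.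
by apply: contra ndm => /(@bihom_form_of _) ->.
Qed.

Lemma ev_form_of s t A :
  ev s t (form_of A) = \sum_(i < a.+1) \sum_(j < b.+1) A i j * (s ^+ i * t ^+ j).
Proof.
rewrite /ev raddf_sum; apply: eq_bigr => i _; rewrite /= raddf_sum.
apply: eq_bigr => j _; rewrite /= mevalZ mpolyX_mon !(rmorphM, rmorphXn) /=.
by rewrite !meval_xvar !meval_yvar !hrow0 !hrow1 !expr1n !mulr1.
Qed.

Lemma ev_form_ofl s t A :
  ev s t (form_of A) = \sum_(i < a.+1) (\sum_(j < b.+1) A i j * t ^+ j) * s ^+ i.
Proof.
rewrite ev_form_of; apply: eq_bigr => i _; rewrite mulr_suml.
by apply: eq_bigr => j _; ring.
Qed.

Lemma ev_form_ofr s t A :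
  ev s t (form_of A) = \sum_(j < b.+1) (\sum_(i < a.+1) A i j * s ^+ i) * t ^+ j.
Proof.
rewrite ev_form_of exchange_big; apply: eq_bigr => i _; rewrite mulr_suml.
by apply: eq_bigr => j _; ring.
Qed.

End Coefficients.

Lemma coef_roots (k : fieldType) n (c : 'I_n -> k) (r : seq k) :
  uniq r -> (n <= size r)%N ->
  (forall x, x \in r -> \sum_(i < n) c i * x ^+ i = 0) -> forall i, c i = 0.
Proof.
move=> r_uniq n_r rc i; pose p := rVpoly (\row_j c j).
have p0 : p = 0.
  apply: contraTeq n_r => p0; rewrite -ltnNge.
  apply: leq_trans (max_poly_roots p0 _ r_uniq) (size_poly _ _).
  apply/allP => x /rc cx; apply/rootP; rewrite (horner_coef_wide _ (size_poly _ _)).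
  by rewrite -[RHS]cx; apply: eq_bigr => j _; rewrite coef_rVpoly_ord mxE.
have <- : (\row_j c j) 0 i = c i by rewrite mxE.
by rewrite -coef_rVpoly_ord -/p p0 coef0.
Qed.

(** * Restricting forms to rulings *)

Section ConfigForms.
Variables (k : fieldType) (al : 'I_4 -> k) (be : 'I_5 -> k).
Hypotheses (al_inj : injective al) (be_inj : injective be).

Variables (a b : nat) (F : cox k).
Hypothesis hF : bihom (a%:Z, b%:Z) F.
Hypothesis F_config : forall i j, config (i, j) -> ev (al i) (be j) F = 0.

Let A := mx_of a b F.
Let FE : form_of A = F := mx_ofK hF.

Let uniq_al (r : seq 'I_4) : uniq r -> uniq (map al r).
Proof. by rewrite map_inj_uniq. Qed.

Let uniq_be (r : seq 'I_5) : uniq r -> uniq (map be r).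
Proof. by rewrite map_inj_uniq. Qed.

Lemma row_coef (t : k) (r : seq 'I_4) :
  uniq r -> (a < size r)%N -> (forall i, i \in r -> ev (al i) t F = 0) ->
  forall i, \sum_(j < b.+1) A i j * t ^+ j = 0.
Proof.
move=> r_uniq ar rF; apply: (coef_roots (uniq_al r_uniq)); rewrite ?size_map //.
by move=> _ /mapP[i /rF Fi ->]; rewrite -ev_form_ofl FE.
Qed.

Lemma col_coef (s : k) (r : seq 'I_5) :
  uniq r -> (b < size r)%N -> (forall j, j \in r -> ev s (be j) F = 0) ->
  forall j, \sum_(i < a.+1) A i j * s ^+ i = 0.
Proof.
move=> r_uniq br rF; apply: (coef_roots (uniq_be r_uniq)); rewrite ?size_map //.
by move=> _ /mapP[j /rF Fj ->]; rewrite -ev_form_ofr FE.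
Qed.

(** On [R] the form has degree at most 1 in [x] and vanishes at two points. *)
Lemma ruling_y s : (a <= 1)%N -> ev s (be (o5 4)) F = 0.
Proof.
move=> a1; rewrite -FE ev_form_ofl big1 // => i _.
rewrite (@row_coef _ [:: o4 0; o4 1]) ?mul0r //.
by move=> i'; rewrite !inE => /orP[]/eqP->; apply: F_config.
Qed.

Lemma ruling_x (i : 'I_4) t : (i < 2)%N -> (b <= 1)%N -> ev (al i) t F = 0.
Proof.
move=> i2 b1; rewrite -FE ev_form_ofr big1 // => j _.
rewrite (@col_coef _ [:: widen_ord (leqnSn 4) i; o5 4]) ?mul0r //.
  by rewrite /= inE andbT; case: i i2 => -[|[|]].
by move=> j'; rewrite !inE => /orP[]/eqP->; apply: F_config;
  rewrite /config /= ?eqxx ?i2 ?orbT.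
Qed.

Lemma config_diag (i : 'I_4) (j : 'I_5) : i = j :> nat -> ev (al i) (be j) F = 0.
Proof. by move=> ij; apply: F_config; rewrite /config /= ij eqxx. Qed.

Hypothesis F0 : F != 0.

Lemma config_absurd : ~ (forall i j, A i j = 0).
Proof.
move=> A0; case/eqP: F0; rewrite -FE /form_of big1 // => i _.
by rewrite big1 // => j _; rewrite A0 scale0r.
Qed.

(** Such a form depends on [y] alone, and each of the five horizontal rulings carries a point,
    giving five roots. *)
Lemma config_x0 : a = 0%N -> (4 < b)%N.
Proof.
move=> a0; rewrite ltnNge; apply/negP => b4; apply: config_absurd => i j.
have ev_s s t : ev s t F = \sum_(j < b.+1) A i j * t ^+ j.
  rewrite -FE ev_form_ofl (bigD1 i) //= [X in _ + X]big1 => [|i'].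
    have -> : i = 0%N :> nat by have := ltn_ord i; lia.
    by rewrite mulr1 addr0.
  rewrite -val_eqE; have := ltn_ord i'; have := ltn_ord i => /=; lia.
apply: (coef_roots (uniq_be (enum_uniq 'I_5))).
  by rewrite size_map size_enum_ord.
move=> _ /mapP[j' _ ->]; rewrite -(ev_s (al (inord (j' %% 4)))).
by apply: F_config; case: j' => [[|[|[|[|[|j']]]]] hj] //; rewrite /config /= inordK.
Qed.

Lemma config_y0 : b = 0%N -> (3 < a)%N.
Proof.
move=> b0; rewrite ltnNge; apply/negP => a3; apply: config_absurd => i j.
have ev_t s t : ev s t F = \sum_(i < a.+1) A i j * s ^+ i.
  rewrite -FE ev_form_ofr (bigD1 j) //= [X in _ + X]big1 => [|j'].
    have -> : j = 0%N :> nat by have := ltn_ord j; lia.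
    by rewrite mulr1 addr0.
  rewrite -val_eqE; have := ltn_ord j'; have := ltn_ord j => /=; lia.
apply: (@coef_roots _ _ (fun i => A i j) _ (uniq_al (enum_uniq 'I_4))).
  by rewrite size_map size_enum_ord.
move=> _ /mapP[i' _ ->]; rewrite -(ev_t _ (be (widen_ord (leqnSn 4) i'))).
exact: config_diag.
Qed.

(** The form contains the vertical rulings of $p_0$ and $p_1$. If $a\le 2$, it has three zeros on
    the horizontal rulings of $p_2$ and of $p_3$, hence contains both, too many for degree 1 in
    [y]. *)
Lemma config_y1 : b = 1%N -> (2 < a)%N.
Proof.
move=> b1; rewrite ltnNge; apply/negP => a2; apply: config_absurd => i.
have row0 (i' : 'I_4) (j' : 'I_5) : i' = j' :> nat -> (1 < i')%N ->
    forall i'', \sum_(j < b.+1) A i'' j * be j' ^+ j = 0.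
  move=> ij i1; apply: (@row_coef _ [:: o4 0; o4 1; i']) => //.
    by rewrite /= !inE -!val_eqE /=; lia.
  move=> i''; rewrite !inE => /or3P[]/eqP->; try by apply: ruling_x; rewrite ?b1.
  exact: config_diag.
apply: (coef_roots (uniq_be (isT : uniq [:: o5 2; o5 3]))); first by rewrite b1.
move=> _ /mapP[j' + ->]; rewrite !inE => /orP[]/eqP->.
  exact: (@row0 (o4 2)).
exact: (@row0 (o4 3)).
Qed.

End ConfigForms.

(* Such a form is a multiple of the equation of the horizontal ruling with two
   points, and the remaining (1, 1)-form vanishes on the other four points. *)
Lemma config_12 (k : fieldType) (al : 'I_4 -> k) (be : 'I_5 -> k) (F : cox k) :
  injective al -> injective be -> be (o5 4) = 0 ->
  (forall (i : 'I_4) (j : 'I_5), (i < 3)%N -> i = j :> nat -> al i * be j = 1) ->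
  al (o4 3) * be (o5 3) != 1 -> bihom (1%:Z, 2%:Z) F ->
  (forall i j, config (i, j) -> ev (al i) (be j) F = 0) -> F = 0.
Proof.
move=> al_inj be_inj be4 albe albe3 /(@mx_ofK _ 1 2) <-; set A := mx_of 1 2 F.
have evE s t : ev s t (form_of A) =
    A 0 0 + A 0 1 * t + A 0 2 * t ^+ 2 +
    (A 1 0 + A 1 1 * t + A 1 2 * t ^+ 2) * s.
  rewrite ev_form_of !big_ord_recl !big_ord0 /=.
  have -> : lift ord0 (ord0 : 'I_1) = 1 by apply: val_inj.
  have -> : lift ord0 (ord0 : 'I_2) = 1 by apply: val_inj.
  have -> : lift ord0 (1 : 'I_2) = 2 by apply: val_inj.
  by rewrite /bump /=; ring.
move=> F0; have {F0}evF i j ij := etrans (esym (evE (al i) (be j))) (F0 i j ij).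
have al01 : al (o4 0) - al (o4 1) != 0 by rewrite subr_eq0 (inj_eq al_inj).
have be0 j : j != o5 4 -> be j != 0.
  by apply: contraNneq => bj; apply/eqP/be_inj; rewrite bj be4.
have e0 : A 0 0 + A 1 0 * al (o4 0) = 0.
  by rewrite -(evF (o4 0) (o5 4)) // be4; ring.
have e1 : A 0 0 + A 1 0 * al (o4 1) = 0.
  by rewrite -(evF (o4 1) (o5 4)) // be4; ring.
have A10 : A 1 0 = 0.
  apply: (mulIf al01); rewrite mul0r -[RHS](subrr 0) -{1}e0 -e1; ring.
have A00 : A 0 0 = 0 by rewrite -e0 A10 mul0r addr0.
have diag (i : 'I_4) (j : 'I_5) : i = j :> nat ->
    A 0 1 + A 0 2 * be j + (A 1 1 + A 1 2 * be j) * al i = 0.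
  move=> ij; have bj0 : be j != 0.
    by apply: be0; rewrite -val_eqE /= -ij; have := ltn_ord i; lia.
  apply: (mulfI bj0); rewrite mulr0 -(evF i j) ?A00 ?A10; first by ring.
  by rewrite /config /= ij eqxx.
(* Multiplying [diag] by [al i] and using [al i * be i = 1] gives a quadratic in [al i], with three
   roots. *)
have quad i : [:: A 0 2; A 0 1 + A 1 2; A 1 1]`_(i : 'I_3) = 0.
  apply: (@coef_roots k 3 (fun i => _`_i) (map al [:: o4 0; o4 1; o4 2])) => //.
    by rewrite map_inj_uniq.
  have root (i' : 'I_4) : (i' < 3)%N ->
      A 0 2 + (A 0 1 + A 1 2) * al i' + A 1 1 * al i' ^+ 2 = 0.
    move=> i3; pose j := widen_ord (leqnSn 4) i'.
    have ab := albe i' j i3 erefl.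
    transitivity (al i' * (A 0 1 + A 0 2 * be j + (A 1 1 + A 1 2 * be j) * al i')).
      by ring: ab.
    by rewrite diag ?mulr0.
  move=> _ /mapP[i' i'_r ->]; rewrite !big_ord_recl big_ord0 /= -[RHS](root i').
    by rewrite /bump /=; ring.
  by move: i'_r; rewrite !inE => /or3P[]/eqP->.
have A02 := quad 0; have A11 := quad 2; have A01 := quad 1; rewrite /= in A02 A11 A01.
(* What remains at the fourth point is $A_{12}(\alpha_3\beta_3-1)=0$. *)
have A12 : A 1 2 = 0.
  move: albe3; rewrite -subr_eq0 => ab3; apply: (mulIf ab3); rewrite mul0r.
  rewrite -(diag (o4 3) (o5 3)) // A02 A11 -[A 0 1](addrK (A 1 2)) A01; ring.
have {}A01 : A 0 1 = 0 by move: A01; rewrite A12 addr0.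
have -> : A = 0; last by rewrite raddf0.
apply/matrixP => i j; rewrite [RHS]mxE.
have [-> | ->] : i = 0 \/ i = 1.
  by case: i => [[|[|//]] hi]; [left | right]; apply: val_inj.
all: have [->|[->|->]] : j = 0 \/ j = 1 \/ j = 2
  by case: j => [[|[|[|//]]] hj]; [left | right; left | right; right]; apply: val_inj.
all: by rewrite ?A00 ?A01 ?A02 ?A10 ?A11 ?A12.
Qed.

(** * The intersection number *)

Section Graded.
Variables (k : fieldType) (S : comNzRingType) (C : {rmorphism k -> S}).
Variables (X0 X1 : S) (G : nat -> S -> Prop).
Hypothesis G0 : forall n, G n 0.
Hypothesis GD : forall n u v, G n u -> G n v -> G n (u + v).
Hypothesis GZ : forall n c u, G n u -> G n (C c * u).
Hypothesis GX0 : forall n u, G n u -> G n.+1 (X0 * u).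
Hypothesis GX1 : forall n u, G n u -> G n.+1 (X1 * u).
Hypothesis Gsplit : forall n u, G n.+1 u ->
  exists v w, [/\ G n v, G n w & u = X0 * v + X1 * w].

Let Gsum n (I : Type) (r : seq I) (F : I -> S) :
  (forall i, G n (F i)) -> G n (\sum_(i <- r) F i).
Proof.
by move=> GF; elim/big_rec: _ => // i u _ Gu; apply: GD.
Qed.

Let GX1n n m u : G n u -> G (m + n) (X1 ^+ m * u).
Proof.
move=> Gu; elim: m => [|m IHm]; first by rewrite mul1r.
by rewrite addSn exprS -mulrA; apply: GX1.
Qed.

Lemma graded_split_pow a b n u : G (a + b + n) u ->
  exists v w, [/\ G (b + n) v, G (a + n) w & u = X0 ^+ a * v + X1 ^+ b * w].
Proof.
elim: a b n u => [|a IHa] b n u.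
  by exists u, 0; rewrite mul1r mulr0 addr0.
elim: b u => [|b IHb] u.
  by rewrite addn0 => Gu; exists 0, u; rewrite mul1r mulr0 add0r.
rewrite addnS !addSn => /Gsplit[v [w [Gv Gw ->]]].
have [] := IHa b.+1 n v; first by rewrite addnS.
move=> v1 [v2 [Gv1 Gv2 ->]].
have [|w1 [w2 [Gw1 Gw2 ->]]] := IHb w; first by rewrite addSn.
exists (v1 + X1 * w1), (X0 * v2 + w2); split.
- by apply: GD => //; apply: GX1.
- by apply: GD => //; apply: GX0.
- by rewrite !exprS; ring.
Qed.

Definition linf (c : k) : S := X0 - C c * X1.
Definition lagr (r : seq k) (c : k) : S := \prod_(b <- r | b != c) linf b.

Lemma lagr_rem (r : seq k) c : uniq r -> c \in r ->
  \prod_(b <- r) linf b = linf c * lagr r c.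
Proof. by move=> r_uniq cr; rewrite (bigD1_seq c). Qed.

(** Lagrange interpolation with one node more than the degree; the values [v c] are forms in the
    other pair of variables, so the induction is on nodes. *)
Lemma lagrange_base (c0 : k) (r : seq k) u : uniq (c0 :: r) -> G (size r) u ->
  exists2 v : k -> S, forall c, G 0 (v c) &
    u = \sum_(c <- c0 :: r) lagr (c0 :: r) c * v c.
Proof.
elim: r c0 u => [|c1 r IHr] c0 u.
  move=> _ Gu; exists (fun=> u) => //.
  by rewrite big_seq1 /lagr big_cons big_nil eqxx mul1r.
rewrite cons_uniq => /andP[c0r c1r_uniq] /Gsplit[v [w [Gv Gw ->]]].
have [v' Gv' {Gv}->] := IHr c1 v c1r_uniq Gv.
have [w' Gw' {Gw}->] := IHr c1 w c1r_uniq Gw.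
set r1 := c1 :: r in c0r c1r_uniq *.
(* From $(c-c_0)X_0=c\,\ell_{c_0}-c_0\,\ell_c$ and $(c-c_0)X_1=\ell_{c_0}-\ell_c$: the parts with
   $\ell_c$ collect in the Lagrange polynomial of [c0]. *)
pose mu c := (c - c0)^-1.
pose z c := C (mu c) * (C c0 * v' c + w' c).
exists (fun c => if c == c0 then - \sum_(c <- r1) z c
                 else C (mu c) * (C c * v' c + w' c)).
  move=> c; case: eqP => _; last by apply/GZ/GD => //; apply: GZ.
  rewrite -mulN1r -(rmorphN1 C); apply: GZ; apply: Gsum => c'.
  by apply/GZ/GD => //; apply: GZ.
have lagr0 : lagr (c0 :: r1) c0 = \prod_(b <- r1) linf b.
  rewrite /lagr big_cons eqxx big_seq_cond [RHS]big_seq; apply: eq_bigl => b.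
  by case: (boolP (b \in r1)) => //= br1; apply: contraTneq br1 => ->.
have lagrS c : c != c0 -> lagr (c0 :: r1) c = linf c0 * lagr r1 c.
  by move=> neq_c; rewrite /lagr big_cons eq_sym neq_c.
rewrite [RHS]big_cons eqxx lagr0 !mulr_sumr -big_split mulrN mulr_sumr -sumrN.
rewrite -big_split /= big_seq [RHS]big_seq; apply: eq_bigr => c cr1.
have neq_c : c != c0 by apply: contraTneq cr1 => ->.
rewrite (negPf neq_c) (lagrS _ neq_c) (lagr_rem c1r_uniq cr1) /z.
have mu1 : C (mu c) * (C c - C c0) = 1.
  by rewrite -rmorphB -rmorphM mulVf ?subr_eq0 ?rmorph1.
transitivity (C (mu c) * (C c - C c0) * lagr r1 c * (X0 * v' c + X1 * w' c)).
  by rewrite mu1; ring.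
by rewrite /linf; ring.
Qed.

(** Since [linf c * lagr c] is the full product, multiplication by [X0] acts on [lagr c] as [c * X1]
    modulo that product; this raises the degree from the base case. *)
Lemma lagrange_form (c0 : k) (r : seq k) d u :
  uniq (c0 :: r) -> G (size r + d.+1) u ->
  exists w (v : k -> S), [/\ G d w, forall c, G 0 (v c) &
    u = (\prod_(c <- c0 :: r) linf c) * w +
        X1 ^+ d.+1 * \sum_(c <- c0 :: r) lagr (c0 :: r) c * v c].
Proof.
move=> r_uniq; set rr := c0 :: r in r_uniq *; set L := \prod_(c <- rr) linf c.
have step e (v : k -> S) :
    X0 * (X1 ^+ e * \sum_(c <- rr) lagr rr c * v c) =
    L * (X1 ^+ e * \sum_(c <- rr) v c) +
    X1 ^+ e.+1 * \sum_(c <- rr) lagr rr c * (C c * v c).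
  rewrite !mulr_sumr -big_split big_seq [RHS]big_seq; apply: eq_bigr => c cr /=.
  by rewrite /L (lagr_rem r_uniq cr) exprS /linf; ring.
elim: d u => [|d IHd] u; rewrite addnS => /Gsplit[u0 [u1 [Gu0 Gu1 ->]]].
  rewrite addn0 in Gu0 Gu1.
  have [v Gv {Gu0}->] := lagrange_base r_uniq Gu0.
  have [w Gw {Gu1}->] := lagrange_base r_uniq Gu1.
  exists (\sum_(c <- rr) v c), (fun c => C c * v c + w c); split.
  - exact: Gsum.
  - by move=> c; apply/GD/Gw/GZ.
  - have := step 0%N v; rewrite !mul1r => ->; rewrite -addrA; congr (_ + _).
    rewrite !expr1 -mulrDr -big_split; congr (_ * _); apply: eq_bigr => c _.
    by rewrite mulrDr.
have [w0 [v0 [Gw0 Gv0 {Gu0}->]]] := IHd _ Gu0.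
have [w1 [v1 [Gw1 Gv1 {Gu1}->]]] := IHd _ Gu1.
exists (X0 * w0 + X1 ^+ d.+1 * (\sum_(c <- rr) v0 c) + X1 * w1).
exists (fun c => C c * v0 c + v1 c); split.
- apply: GD; last exact: GX1.
  by apply: GD; [apply: GX0 | by have := GX1n d.+1 (Gsum rr Gv0); rewrite addn0].
- by move=> c; apply/GD/Gv1/GZ.
- rewrite mulrDr step.
  have -> : \sum_(c <- rr) lagr rr c * (C c * v0 c + v1 c) =
    \sum_(c <- rr) lagr rr c * (C c * v0 c) + \sum_(c <- rr) lagr rr c * v1 c.
    by rewrite -big_split; apply: eq_bigr => c _; rewrite mulrDr.
  by rewrite !exprS; ring.
Qed.

Lemma lagrange_decomposition (r : seq k) d u : uniq r -> G (size r + d) u ->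
  exists w (v : k -> S), [/\ G d w, forall c, G 0 (v c) &
    u = (\prod_(c <- r) linf c) * w +
        X1 ^+ d.+1 * \sum_(c <- r) lagr r c * v c].
Proof.
case: r => [_ Gu|c r r_uniq]; last by rewrite addSnnS; apply: lagrange_form.
by exists u, (fun=> 0); rewrite !big_nil mul1r mulr0 addr0.
Qed.

End Graded.

Lemma dim_exact (K : fieldType) (U V W : vectType K)
    (kappa : {linear U -> V}) (phi : {linear V -> W}) :
  injective kappa -> (forall w, exists v, phi v = w) ->
  (forall u, phi (kappa u) = 0) -> (dim U + dim W <= dim V)%N.
Proof.
move=> kappa_inj phi_surj phi_kappa.
have im_phi : limg (linfun phi) = fullv.
  apply/eqP; rewrite eqEsubv subvf; apply/subvP => w _.
  have [v <-] := phi_surj w; rewrite -[phi v](lfunE phi).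
  by apply: memv_img; rewrite memvf.
have ker_kappa : lker (linfun kappa) == 0%VS.
  by apply/lker0P => u u'; rewrite !lfunE => /kappa_inj.
have im_kappa : (limg (linfun kappa) <= lker (linfun phi))%VS.
  apply/subvP => _ /memv_imgP[u _ ->]; rewrite memv_ker !lfunE /=.
  by apply/eqP/phi_kappa.
rewrite -(dimvf U) -(dimvf W) -(dimvf V) -im_phi.
rewrite -(limg_ker_dim (linfun phi) fullv) leq_add2r capfv.
apply: leq_trans (dimvS im_kappa); rewrite limg_dim_eq //.
by rewrite (eqP ker_kappa) capv0.
Qed.

Lemma card_config : #|{: {ij | config ij}}| = 6%N.
Proof.
rewrite card_sig -(@eq_card _ (mem config_seq)) => [|ij]; last exact: mem_config_seq.
by rewrite (card_uniqP _).
Qed.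

(** * Counting forms modulo two equations *)

Section IntersectionNumber.
Variable k : fieldType.
Local Notation S := (cox k).
Local Notation x0 := (xvar k 0).
Local Notation x1 := (xvar k 1).
Local Notation y0 := (yvar k 0).
Local Notation y1 := (yvar k 1).
Local Notation bideg a b := (Posz a, Posz b).

Lemma bihomMn a b c d (u v : S) :
  bihom (bideg a b) u -> bihom (bideg c d) v -> bihom (bideg (a + c) (b + d)) (u * v).
Proof. by move=> hu hv; apply: (bihomM hu hv). Qed.

Lemma bihom_mulx i a b (u : S) :
  bihom (bideg a b) u -> bihom (bideg a.+1 b) (xvar k i * u).
Proof. exact: bihomMn (@bihom_xvar k i). Qed.

Lemma bihom_muly i a b (u : S) :
  bihom (bideg a b) u -> bihom (bideg a b.+1) (yvar k i * u).
Proof. exact: bihomMn (@bihom_yvar k i). Qed.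

Lemma bihom_mulxn i e a b (u : S) :
  bihom (bideg a b) u -> bihom (bideg (e + a) b) (xvar k i ^+ e * u).
Proof.
by move=> hu; elim: e => [|e IHe]; rewrite ?mul1r // exprS -mulrA; apply: bihom_mulx.
Qed.

Lemma bihom_mulyn i e a b (u : S) :
  bihom (bideg a b) u -> bihom (bideg a (e + b)) (yvar k i ^+ e * u).
Proof.
by move=> hu; elim: e => [|e IHe]; rewrite ?mul1r // exprS -mulrA; apply: bihom_muly.
Qed.

Lemma bihom_mulC d (c : k) (u : S) : bihom d u -> bihom d (c%:MP * u).
Proof. by rewrite mul_mpolyC; apply: bihomZ. Qed.

Lemma bihom_split_pow_x m n r p (u : S) : bihom (bideg (m + n + r) p) u ->
  exists v w, [/\ bihom (bideg (n + r) p) v, bihom (bideg (m + r) p) w &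
    u = x0 ^+ m * v + x1 ^+ n * w].
Proof.
apply: (@graded_split_pow S x0 x1 (fun e => bihom (bideg e p))) => *.
- exact: bihom0.
- exact: bihomD.
- exact: bihom_mulx.
- exact: bihom_mulx.
- exact: bihom_split_x.
Qed.

Lemma bihom_split_pow_y m n r p (u : S) : bihom (bideg p (m + n + r)) u ->
  exists v w, [/\ bihom (bideg p (n + r)) v, bihom (bideg p (m + r)) w &
    u = y0 ^+ m * v + y1 ^+ n * w].
Proof.
apply: (@graded_split_pow S y0 y1 (fun e => bihom (bideg p e))) => *.
- exact: bihom0.
- exact: bihomD.
- exact: bihom_muly.
- exact: bihom_muly.
- exact: bihom_split_y.
Qed.

Lemma lagrange_x (r : seq k) n p (u : S) : uniq r ->
  bihom (bideg (size r + n) p) u ->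
  exists w (v : k -> S), [/\ bihom (bideg n p) w, forall s, bihom (bideg 0 p) (v s) &
    u = (\prod_(s <- r) lin_x s) * w +
        x1 ^+ n.+1 * \sum_(s <- r) lagr (@mpolyC (2 + 2) k) x0 x1 r s * v s].
Proof.
apply: (@lagrange_decomposition k S (@mpolyC (2 + 2) k) x0 x1
  (fun e => bihom (bideg e p))) => *.
- exact: bihom0.
- exact: bihomD.
- exact: bihom_mulC.
- exact: bihom_mulx.
- exact: bihom_mulx.
- exact: bihom_split_x.
Qed.

Lemma lagrange_y (r : seq k) n p (u : S) : uniq r ->
  bihom (bideg p (size r + n)) u ->
  exists w (v : k -> S), [/\ bihom (bideg p n) w, forall s, bihom (bideg p 0) (v s) &
    u = (\prod_(s <- r) lin_y s) * w +
        y1 ^+ n.+1 * \sum_(s <- r) lagr (@mpolyC (2 + 2) k) y0 y1 r s * v s].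
Proof.
apply: (@lagrange_decomposition k S (@mpolyC (2 + 2) k) y0 y1
  (fun e => bihom (bideg p e))) => *.
- exact: bihom0.
- exact: bihomD.
- exact: bihom_mulC.
- exact: bihom_muly.
- exact: bihom_muly.
- exact: bihom_split_y.
Qed.

Lemma bihom_const (u : S) : bihom (bideg 0 0) u -> exists c : k, u = c%:MP.
Proof.
move=> /mx_ofK <-; exists (mx_of 0 0 u 0 0).
by rewrite /form_of !big_ord1 mpolyX_mon !expr0 !mulr1 -alg_mpolyC.
Qed.

Lemma mx_of_bihom a b d (u : S) : bihom d u -> d != bideg a b -> mx_of a b u = 0.
Proof.
move=> hu neq_d; apply/matrixP => i j; rewrite !mxE memN_msupp_eq0 //.
apply: contra neq_d => /hu <-.
by rewrite (@mbideg_mon a b i j (ltn_ord i) (ltn_ord j)).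
Qed.

(* In a product with a form only one graded component of the other factor
   contributes to a given bidegree. *)
Lemma mx_of_mul a b c d p q (u f : S) : bihom (bideg c d) f ->
  p = (a + c)%N -> q = (b + d)%N ->
  mx_of p q (u * f) = mx_of p q (form_of (mx_of a b u) * f).
Proof.
move=> hf -> ->; elim/mpolyind: u => [|e m u _ _ IHu]; first by rewrite !raddf0.
rewrite raddfD /= raddfD /= !mulrDl !raddfD /= {}IHu; congr (_ + _).
have hm : bihom (mbideg m) (e *: 'X_[m] : S).
  by apply: bihomZ; apply: bihom_monomial.
have [dm|ndm] := eqVneq (mbideg m) (bideg a b).
  by rewrite dm in hm; rewrite (mx_ofK hm).
rewrite (mx_of_bihom hm ndm) raddf0 mul0r raddf0.
apply: mx_of_bihom (bihomM hm hf) _; apply: contra ndm => /eqP dm.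
by apply/eqP/(addIr (bideg c d)); rewrite dm.
Qed.

Variables (al : 'I_4 -> k) (be : 'I_5 -> k).
Hypotheses (al_inj : injective al) (be_inj : injective be).

Definition lagr_x i : S := lagr (@mpolyC (2 + 2) k) x0 x1 (map al (enum 'I_4)) (al i).
Definition lagr_y j : S := lagr (@mpolyC (2 + 2) k) y0 y1 (map be (enum 'I_5)) (be j).

Variables (f g : S) (a b c d M : nat).
Hypotheses (f0 : f != 0) (g0 : g != 0).
Hypotheses (hf : bihom (bideg a b) f) (hg : bihom (bideg c d) g).

Let K := ideal2 f g.

Hypothesis K_x : forall i j : 'I_2,
  K ((xvar k i * yvar k j) ^+ M * \prod_i lin_x (al i)).
Hypothesis K_y : forall i j : 'I_2,
  K ((xvar k i * yvar k j) ^+ M * \prod_j lin_y (be j)).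
Hypothesis K_lagr : forall i j, ~~ config (i, j) ->
  K ((x1 * y1) ^+ M * (lagr_x i * lagr_y j)).

(** A form of bidegree at least (2M, 2M) lies in the ideal of the four elements $(x_iy_j)^M$. *)
Lemma bihom_big_mul m n (u v : S) :
  (forall i j : 'I_2, K ((xvar k i * yvar k j) ^+ M * u)) ->
  (M + M <= m)%N -> (M + M <= n)%N -> bihom (bideg m n) v -> K (u * v).
Proof.
move=> Ku Mm Mn hv; rewrite -(subnKC Mm) -(subnKC Mn) in hv.
have Ky i m' (w : S) : bihom (bideg m' (M + M + (n - (M + M)))) w ->
    K (u * (xvar k i ^+ M * w)).
  move=> /bihom_split_pow_y[w0 [w1 [_ _ ->]]].
  have -> : u * (xvar k i ^+ M * (y0 ^+ M * w0 + y1 ^+ M * w1)) =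
      w0 * ((xvar k i * y0) ^+ M * u) + w1 * ((xvar k i * y1) ^+ M * u).
    by rewrite !exprMn; ring.
  by apply: ideal2D; apply: ideal2M; apply: Ku.
have [v0 [v1 [hv0 hv1 ->]]] := bihom_split_pow_x hv.
by rewrite mulrDr; apply: ideal2D; apply: Ky; eassumption.
Qed.

Section Generation.
Variables m n : nat.
Hypotheses (Mm : (M + M <= m)%N) (Mn : (M + M <= n)%N).

(** The Lagrange polynomial of a point, of bidegree (3, 4), padded to bidegree (4 + m, 5 + n). *)
Definition mod_gen (p : {ij | config ij}) : S :=
  x1 ^+ m.+1 * (y1 ^+ n.+1 * (lagr_x (val p).1 * lagr_y (val p).2)).

Definition generated (u : S) : Prop :=
  exists r : {ffun {ij | config ij} -> k^o},
    K (u - \sum_p r p *: mod_gen p).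

Lemma generated_ideal u : K u -> generated u.
Proof.
move=> Ku; exists 0; rewrite big1 ?subr0 // => p _.
by rewrite ffunE scale0r.
Qed.

Lemma generatedD u v : generated u -> generated v -> generated (u + v).
Proof.
move=> [r Kr] [r' Kr']; exists (r + r').
have -> : \sum_p (r + r') p *: mod_gen p =
    \sum_p r p *: mod_gen p + \sum_p r' p *: mod_gen p.
  by rewrite -big_split; apply: eq_bigr => p _; rewrite ffunE scalerDl.
by rewrite opprD addrACA; apply: ideal2D.
Qed.

Lemma generated_sum (I : eqType) (r : seq I) (F : I -> S) :
  (forall i, i \in r -> generated (F i)) -> generated (\sum_(i <- r) F i).
Proof.
move=> rF; rewrite big_seq; elim/big_rec: _ => [|i u ri hu].
  by apply: generated_ideal; apply: ideal2_0.
by apply: generatedD => //; apply: rF.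
Qed.

(** Interpolation in [x], then in [y]: the quotient terms are multiples of the products of all
    parallel rulings and fall into [K], as do the Lagrange polynomials of the grid positions outside
    the configuration. *)
Lemma forms_generated u : bihom (bideg (4 + m) (5 + n)) u -> generated u.
Proof.
have al_uniq : uniq (map al (enum 'I_4)) by rewrite map_inj_uniq ?enum_uniq.
have be_uniq : uniq (map be (enum 'I_5)) by rewrite map_inj_uniq ?enum_uniq.
have := @lagrange_x (map al (enum 'I_4)) m (5 + n) u al_uniq.
rewrite size_map size_enum_ord => /[apply] -[w [v [hw hv ->]]].
apply: generatedD.
  apply: generated_ideal; apply: (bihom_big_mul _ Mm _ hw); last by lia.
  by rewrite big_map big_enum.
rewrite mulr_sumr big_map; apply: generated_sum => i _; rewrite -/(lagr_x i).
have := @lagrange_y (map be (enum 'I_5)) n 0 (v (al i)) be_uniq.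
rewrite size_map size_enum_ord => /(_ (hv _))[z [s [hz hs ->]]].
rewrite !mulrDr; apply: generatedD.
  apply: generated_ideal; set N := \prod_(_ <- _) _.
  have -> : x1 ^+ m.+1 * (lagr_x i * (N * z)) =
      lagr_x i * (N * (x1 ^+ m.+1 * z)) by ring.
  apply: ideal2M; apply: (@bihom_big_mul m.+1 n) => //; last 2 first.
  - by lia.
  - by have := @bihom_mulxn 1 m.+1 _ _ _ hz; rewrite addn0.
  - by rewrite /N big_map big_enum.
rewrite !mulr_sumr big_map; apply: generated_sum => j _; rewrite -/(lagr_y j).
have [e ->] := bihom_const (hs (be j)).
have -> : x1 ^+ m.+1 * (lagr_x i * (y1 ^+ n.+1 * (lagr_y j * e%:MP))) =
    e *: (x1 ^+ m.+1 * (y1 ^+ n.+1 * (lagr_x i * lagr_y j))).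
  by rewrite -mul_mpolyC; ring.
have [ij|nij] := boolP (config (i, j)).
  exists [ffun p => if val p == (i, j) then e else 0].
  rewrite (bigD1 (exist _ (i, j) ij)) //= [X in _ - (_ + X)]big1 => [|p].
    by rewrite ffunE eqxx addr0 subrr; apply: ideal2_0.
  by rewrite ffunE -val_eqE /= => /negPf ->; rewrite scale0r.
apply: generated_ideal.
have -> : e *: (x1 ^+ m.+1 * (y1 ^+ n.+1 * (lagr_x i * lagr_y j))) =
    e%:MP * x1 ^+ (m.+1 - M) * y1 ^+ (n.+1 - M) *
    ((x1 * y1) ^+ M * (lagr_x i * lagr_y j)).
  rewrite -mul_mpolyC exprMn.
  have {1}-> : m.+1 = (m.+1 - M + M)%N by lia.
  have {1}-> : n.+1 = (n.+1 - M + M)%N by lia.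
  by rewrite !exprD; ring.
by apply: ideal2M; apply: K_lagr.
Qed.

End Generation.

(** The map $(u,v,r)\mapsto uf+vg+\sum_p r_pe_p$, with $e_p$ the six generators, is onto, and its
    kernel contains all multiples of the syzygy (g, -f). In the dimension count everything cancels
    except $ad+bc$ and 6. *)
Lemma intersection_bound : (a * d + b * c <= 6)%N.
Proof.
(* Chosen so that $(4+m,5+n)=(p+a+c,q+b+d)$ with [m], [n] at least [2M]. *)
set p := (4 + (M + M))%N; set q := (5 + (M + M))%N.
set m := (a + c + (M + M))%N; set n := (b + d + (M + M))%N.
pose V := ('M[k]_((c + p).+1, (d + q).+1) * 'M[k]_((a + p).+1, (b + q).+1) *
  {ffun {ij | config ij} -> k^o})%type.
pose phi (v : V) := mx_of (4 + m) (5 + n)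
  (form_of v.1.1 * f + form_of v.1.2 * g + \sum_p v.2 p *: mod_gen m n p).
pose kappa (z : 'M[k]_(p.+1, q.+1)) : V :=
  (mx_of (c + p) (d + q) (form_of z * g), - mx_of (a + p) (b + q) (form_of z * f), 0).
have phi_lin : linear phi.
  move=> e u v; rewrite /phi -linearP; congr mx_of.
  have -> : \sum_p (e *: u.2 + v.2) p *: mod_gen m n p =
      e *: (\sum_p u.2 p *: mod_gen m n p) + \sum_p v.2 p *: mod_gen m n p.
    rewrite scaler_sumr -big_split; apply: eq_bigr => r _.
    by rewrite !ffunE scalerDl scalerA.
  by rewrite !linearP /= -!mul_mpolyC; ring.
have kappa_lin : linear kappa.
  move=> e u v; congr (_, _, _); last by rewrite /= scaler0 addr0.
    by rewrite !linearP mulrDl -scalerAl /= linearP.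
  by rewrite linearP mulrDl -scalerAl /= linearP opprD scalerN.
pose Phi : {linear V -> 'M[k]_((4 + m).+1, (5 + n).+1)} :=
  HB.pack phi (GRing.isLinear.Build _ _ _ _ phi phi_lin).
pose Kappa : {linear 'M[k]_(p.+1, q.+1) -> V} :=
  HB.pack kappa (GRing.isLinear.Build _ _ _ _ kappa kappa_lin).
have hg' (z : 'M[k]_(p.+1, q.+1)) : bihom (bideg (c + p) (d + q)) (form_of z * g : S).
  rewrite [(c + p)%N]addnC [(d + q)%N]addnC.
  by apply: bihomMn => //; exact: bihom_form_of.
have hf' (z : 'M[k]_(p.+1, q.+1)) : bihom (bideg (a + p) (b + q)) (form_of z * f : S).
  rewrite [(a + p)%N]addnC [(b + q)%N]addnC.
  by apply: bihomMn => //; exact: bihom_form_of.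
have := @dim_exact k _ _ _ Kappa Phi.
have dimV : dim V = ((c + p).+1 * (d + q).+1 + (a + p).+1 * (b + q).+1 + 6 * 1)%N.
  by rewrite -card_config.
rewrite dimV !dim_matrix => dim_le.
suff : (p.+1 * q.+1 + (4 + m).+1 * (5 + n).+1 <=
  (c + p).+1 * (d + q).+1 + (a + p).+1 * (b + q).+1 + 6 * 1)%N.
  by rewrite /m /n /p /q; nia.
apply: dim_le => [z z' [eq_g _]|w|z].
- apply: (can_inj (@form_ofK _ p q)); apply: (mulIf g0).
  by rewrite -(mx_ofK (hg' z)) -(mx_ofK (hg' z')) eq_g.
- have [//|//||r [e [e' uE]]] := @forms_generated m n _ _ (form_of w).
  + by rewrite /m; lia.
  + by rewrite /n; lia.
  + exact: bihom_form_of.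
  exists (mx_of (c + p) (d + q) e, mx_of (a + p) (b + q) e', r).
  have [em en] : (4 + m = c + p + a)%N /\ (5 + n = d + q + b)%N.
    by rewrite /m /n /p /q; lia.
  have [em' en'] : (4 + m = a + p + c)%N /\ (5 + n = b + q + d)%N.
    by rewrite /m /n /p /q; lia.
  rewrite /= /phi /= !linearD /= -(mx_of_mul e hf em en) -(mx_of_mul e' hg em' en').
  rewrite -[RHS]form_ofK -[in RHS](subrK (\sum_p r p *: mod_gen m n p) (form_of w)).
  by rewrite uE !linearD.
- rewrite /= /phi /= mx_ofK // linearN /= mx_ofK // big1 => [|r _].
    by rewrite addr0 mulNr mulrAC subrr raddf0.
  by rewrite ffunE scale0r.
Qed.

End IntersectionNumber.

(** * Points in general position *)

(** The excluded cases force all four degrees to be at least 2, whence $ad+bc\ge 8$. *)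
Lemma degrees_absurd a b c d : (a * d + b * c <= 6)%N ->
  ~ ((a <= 1) && (c <= 1))%N -> ~ ((b <= 1) && (d <= 1))%N ->
  (a = 0 -> 4 < b)%N -> (b = 0 -> 3 < a)%N -> (b = 1 -> 2 < a)%N ->
  ~ (a = 1 /\ b = 2)%N ->
  (c = 0 -> 4 < d)%N -> (d = 0 -> 3 < c)%N -> (d = 1 -> 2 < c)%N ->
  ~ (c = 1 /\ d = 2)%N -> False.
Proof.
move=> le6 ac bd a0 b0 b1 ab c0 d0 d1 cd.
have b2 : (1 < b)%N.
  by case: b le6 bd a0 b0 b1 ab => [|[|b]] //; case: d c0 d0 d1 cd => [|[|d]] //; nia.
have d2 : (1 < d)%N.
  by case: d le6 bd c0 d0 d1 cd => [|[|d]] //; nia.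
have a2 : (1 < a)%N.
  by case: a le6 ac a0 b0 b1 ab => [|[|a]] //; case: c c0 d0 d1 cd => [|[|c]] //; nia.
have c2 : (1 < c)%N.
  by case: c le6 ac c0 d0 d1 cd => [|[|c]] //; nia.
nia.
Qed.

Lemma uniform_bound (T : finType) (Q : T -> nat -> Prop) :
  (forall t m n, (m <= n)%N -> Q t m -> Q t n) ->
  (forall t, exists n, Q t n) -> exists n, forall t, Q t n.
Proof.
move=> Qle /fin_all_exists[F QF]; exists (\max_t F t) => t.
exact: Qle (leq_bigmax t) (QF t).
Qed.

Lemma sheaf_iso_sym (k : fieldType) (M N : bimod k) : sheaf_iso M N -> sheaf_iso N M.
Proof. by case=> phi [psi [h1 h2 h3 h4]]; exists psi, phi; split. Qed.

Lemma bihom_prod (k : fieldType) (I : Type) (r : seq I) (P : pred I)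
    (D : I -> int * int) (F : I -> cox k) :
  (forall i, P i -> bihom (D i) (F i)) ->
  bihom (\sum_(i <- r | P i) D i) (\prod_(i <- r | P i) F i).
Proof.
move=> hF; elim/big_rec2: _ => [|i u d Pi hu]; first exact: bihom1.
by apply: bihomM => //; apply: hF.
Qed.

Section NotVCI.
Variables (k : fieldType) (al : 'I_4 -> k) (be : 'I_5 -> k).
Hypotheses (al_inj : injective al) (be_inj : injective be).

Lemma lagr_xE i : lagr_x al i = \prod_(i' | i' != i) lin_x (al i').
Proof.
rewrite /lagr_x /lagr big_map big_enum_cond; apply: eq_big => // i'.
by rewrite inE (inj_eq al_inj).
Qed.

Lemma lagr_yE j : lagr_y be j = \prod_(j' | j' != j) lin_y (be j').
Proof.
rewrite /lagr_y /lagr big_map big_enum_cond; apply: eq_big => // j'.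
by rewrite inE (inj_eq be_inj).
Qed.

Lemma bihom_lagr i j :
  bihom (\sum_(i' | i' != i) (1, 0) + \sum_(j' | j' != j) (0, 1))
        (lagr_x al i * lagr_y be j).
Proof.
rewrite lagr_xE lagr_yE; apply: bihomM; apply: bihom_prod => *.
  exact: bihom_lin_x.
exact: bihom_lin_y.
Qed.

Lemma ev_lagr i j : ev (al i) (be j) (lagr_x al i * lagr_y be j) != 0.
Proof.
rewrite lagr_xE lagr_yE /ev mevalM !rmorph_prod /= mulf_neq0 //.
  apply/prodf_neq0 => i' neq_i; rewrite meval_lin_x hrow0 hrow1 mulr1.
  by rewrite subr_eq0 eq_sym (inj_eq al_inj).
apply/prodf_neq0 => j' neq_j; rewrite meval_lin_y hrow0 hrow1 mulr1.
by rewrite subr_eq0 eq_sym (inj_eq be_inj).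
Qed.

Lemma vanishing_prod_x : vanishing_ideal (grid al be) (\prod_i lin_x (al i)).
Proof.
apply/vanishing_gridP => i j c d _ _ _; rewrite rmorph_prod (bigD1 i) //=.
by rewrite meval_lin_x !mxE /=; ring.
Qed.

Lemma vanishing_prod_y : vanishing_ideal (grid al be) (\prod_j lin_y (be j)).
Proof.
apply/vanishing_gridP => i j c d _ _ _; rewrite rmorph_prod (bigD1 j) //=.
by rewrite meval_lin_y !mxE /=; ring.
Qed.

Lemma vanishing_lagr i j : ~~ config (i, j) ->
  vanishing_ideal (grid al be) (lagr_x al i * lagr_y be j).
Proof.
move=> nij; apply/vanishing_gridP => i' j' c d ij _ _.
rewrite lagr_xE lagr_yE mevalM !rmorph_prod /=.
have [eq_i|neq_i] := eqVneq i' i; last first.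
  by rewrite (bigD1 i') //= meval_lin_x !mxE /=; ring.
have neq_j : j' != j by apply: contraNneq nij => <-; rewrite -eq_i.
by rewrite [X in _ * X](bigD1 j') //= meval_lin_y !mxE /=; ring.
Qed.

Variables (df dg : int * int) (f g : cox k) (hf : bihom df f) (hg : bihom dg g).
Hypothesis iso : sheaf_iso (quot_mod (vanishing_ideal (grid al be)))
                           (coker_mod (koszul hf hg)).

Let A (v : 'rV[cox k]_1) := vanishing_ideal (grid al be) (v 0 0).
Let B (v : 'rV[cox k]_1) := exists w : 'rV[cox k]_2, v = w *m koszul_diff f g 0.

Lemma dopen_xy i j : dopen (xvar k i * yvar k j) (1, 1).
Proof.
split=> //; have -> : (1, 1) = (1, 0) + (0, 1) :> (int * int)%type by [].
by apply: bihomM; [apply: bihom_xvar | apply: bihom_yvar].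
Qed.

Lemma bideg11 n : (1, 1) *+ n = (n%:Z, n%:Z) :> (int * int)%type.
Proof. by elim: n => // n IHn; rewrite mulrS IHn. Qed.

(** Numerators over powers of $x_iy_j$ need equal degrees in both blocks; the padding is invertible
    there. *)
Lemma balance (i j : 'I_2) (a b : nat) (u : cox k) : bihom (a%:Z, b%:Z) u ->
  bihom ((1, 1) *+ (a + b)) (xvar k i ^+ b * (yvar k j ^+ a * u)).
Proof.
by move=> hu; rewrite bideg11 {1}addnC; apply/bihom_mulxn/bihom_mulyn.
Qed.

Lemma vanishing_koszul i j d u : bihom d u -> vanishing_ideal (grid al be) u ->
  exists n, ideal2 f g ((xvar k i * yvar k j) ^+ n * u).
Proof.
have [->|u0] := eqVneq u 0; first by exists 0%N; rewrite mulr0; apply: ideal2_0.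
move=> hu Iu; have [a [b def_d]] := bihom_nat u0 hu; rewrite {}def_d in hu.
have := @sheaf_iso_loc k A B _ _ (a + b)
  (const_mx (xvar k i ^+ b * (yvar k j ^+ a * u))) (vanishing_submodule _)
  (koszul_submodule _ _) iso (dopen_xy i j).
rewrite {1}mxE => /(_ (balance hu)) [|n].
  move=> p s t *; rewrite mxE !mevalM.
  by rewrite (Iu p s t) ?mulr0.
move=> /koszul_imageP; rewrite !mxE => Kn; exists (n + (a + b))%N.
have -> : (xvar k i * yvar k j) ^+ (n + (a + b)) * u =
    xvar k i ^+ a * yvar k j ^+ b * ((xvar k i * yvar k j) ^+ n *
      (xvar k i ^+ b * (yvar k j ^+ a * u))).
  by rewrite !exprD !exprMn; ring.
exact: ideal2M.
Qed.

(** In the chart where $x_1y_1$ is inverted, [(f, g)] and the vanishing ideal agree, and the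
    inverted factors take the value 1 at every point. *)
Lemma koszul_vanishing d u : bihom d u -> ideal2 f g u ->
  forall i j, config (i, j) -> ev (al i) (be j) u = 0.
Proof.
have [->|u0] := eqVneq u 0; first by move=> *; rewrite /ev meval0.
move=> hu Ku i j ij; have [a [b def_d]] := bihom_nat u0 hu; rewrite {}def_d in hu.
have := @sheaf_iso_loc k B A _ _ (a + b)
  (const_mx (xvar k 1 ^+ b * (yvar k 1 ^+ a * u))) (koszul_submodule _ _)
  (vanishing_submodule _) (sheaf_iso_sym iso) (dopen_xy 1 1).
rewrite {1}mxE => /(_ (balance hu)) [|n].
  by apply/koszul_imageP; rewrite mxE; do 2!apply: ideal2M.
move=> /vanishing_grid_ev/(_ ij); rewrite !mxE /ev !(mevalM, rmorphXn) /= mevalM.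
by rewrite meval_xvar meval_yvar !hrow1 mulr1 !expr1n !mul1r.
Qed.

(** The Lagrange polynomial of a grid position outside the configuration vanishes on the
    configuration, so a monomial multiple of it lies in [(f, g)]; yet its value at that position is
    nonzero. *)
Lemma koszul_common_zero i j : ~~ config (i, j) ->
  ~ (ev (al i) (be j) f = 0 /\ ev (al i) (be j) g = 0).
Proof.
move=> nij [f0 g0].
have [n [c [d]]] := vanishing_koszul 1 1 (@bihom_lagr i j) (vanishing_lagr nij).
move=> /(congr1 (ev (al i) (be j))); rewrite /ev mevalM mevalD !mevalM.
rewrite -/(ev _ _ f) -/(ev _ _ g) f0 g0 !mulr0 addr0 rmorphXn /= mevalM.
rewrite meval_xvar meval_yvar !hrow1 mulr1 expr1n mul1r -mevalM.
by apply/eqP; apply: ev_lagr.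
Qed.

End NotVCI.

Lemma ideal_pow_irrelevant (k : fieldType) l :
  ideal_pow (@irrelevant k) l ((xvar k 1 * yvar k 1) ^+ l).
Proof.
exists 1%N, (fun=> 1), (fun _ _ => xvar k 1 * yvar k 1); split=> [_ _|].
  split.
    exists (fun i => if i == 0 then 0 else yvar k 1).
    by rewrite sum_I2 /= mul0r add0r mulrC.
  exists (fun i => if i == 0 then 0 else xvar k 1).
  by rewrite sum_I2 /= mul0r add0r.
by rewrite big_ord1 prodr_const card_ord mul1r.
Qed.

Lemma not_VCI_grid (k : fieldType) (al : 'I_4 -> k) (be : 'I_5 -> k) :
  injective al -> injective be -> be (o5 4) = 0 ->
  (forall (i : 'I_4) (j : 'I_5), (i < 3)%N -> i = j :> nat -> al i * be j = 1) ->
  al (o4 3) * be (o5 3) != 1 -> ~ VCI (grid al be).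
Proof.
move=> al_inj be_inj be4 albe albe3 [df [dg [f [g [hf [hg [ann iso]]]]]]].
have Kf : ideal2 f g f by rewrite -{2}[f]mul1r; apply: ideal2_l.
have Kg : ideal2 f g g by rewrite -{2}[g]mul1r; apply: ideal2_r.
have f_config := koszul_vanishing iso hf Kf.
have g_config := koszul_vanishing iso hg Kg.
have [l _ annl] := ann 0%N.
have not_dvd (w u : cox k) : ev (al (o4 0)) (be (o5 0)) u = 0 ->
    (xvar k 1 * yvar k 1) ^+ l <> w * u.
  move=> u0 /(congr1 (ev (al (o4 0)) (be (o5 0)))) /eqP.
  rewrite /ev rmorphXn /= !mevalM -/(ev _ _ u) u0 mulr0 meval_xvar meval_yvar.
  by rewrite !hrow1 mulr1 expr1n oner_eq0.
have annE (v : 'rV[cox k]_2) : v 0 0 * f + v 0 1 * g = 0 ->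
    exists w, (xvar k 1 * yvar k 1) ^+ l * v 0 0 = - w * g /\
              (xvar k 1 * yvar k 1) ^+ l * v 0 1 = w * f.
  move=> v0; have [|w /rowP wE] := annl _ (ideal_pow_irrelevant k l) v.
    by apply/rowP => i; rewrite ord1 !mxE sum_I2 !mxE.
  exists (w 0 0); have := wE 0; have := wE 1.
  by rewrite !mxE !big_ord1 !mxE /= mulrN mulNr.
(* If [f = 0], then (1, 0) is a cycle, so a power of $x_1y_1$ would be a multiple of [g], which
   vanishes at $p_0$. *)
have f0 : f != 0.
  apply/eqP => f0; have [|w []] := annE (\row_j (if j == 0 then 1 else 0)).
    by rewrite !mxE f0 /= mulr0 mul0r addr0.
  by rewrite mxE mulr1 => /not_dvd; case; apply: g_config.
have g0 : g != 0.
  apply/eqP => g0; have [|w [_]] := annE (\row_j (if j == 0 then 0 else 1)).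
    by rewrite !mxE g0 /= mulr0 mul0r addr0.
  by rewrite mxE mulr1 => /not_dvd; case; apply: f_config.
have [a [b def_df]] := bihom_nat f0 hf; have [c [d def_dg]] := bihom_nat g0 hg.
have hf' : bihom (a%:Z, b%:Z) f by rewrite -def_df.
have hg' : bihom (c%:Z, d%:Z) g by rewrite -def_dg.
have K_le (s u : cox k) m n : (m <= n)%N ->
    ideal2 f g (s ^+ m * u) -> ideal2 f g (s ^+ n * u).
  by move=> mn Ku; rewrite -(subnK mn) exprD -mulrA; apply: ideal2M.
have [M1 K_x] : exists n, forall t : 'I_2 * 'I_2,
    ideal2 f g ((xvar k t.1 * yvar k t.2) ^+ n * \prod_i lin_x (al i)).
  apply: uniform_bound => [t m n|t]; first exact: K_le.
  apply: (vanishing_koszul iso); last exact: vanishing_prod_x.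
  by apply: bihom_prod => i _; apply: bihom_lin_x.
have [M2 K_y] : exists n, forall t : 'I_2 * 'I_2,
    ideal2 f g ((xvar k t.1 * yvar k t.2) ^+ n * \prod_j lin_y (be j)).
  apply: uniform_bound => [t m n|t]; first exact: K_le.
  apply: (vanishing_koszul iso); last exact: vanishing_prod_y.
  by apply: bihom_prod => j _; apply: bihom_lin_y.
have [M3 K_lagr] : exists n, forall t : 'I_4 * 'I_5, ~~ config t ->
    ideal2 f g ((xvar k 1 * yvar k 1) ^+ n * (lagr_x al t.1 * lagr_y be t.2)).
  apply: uniform_bound => [t m n mn Km nt|t]; first exact: K_le mn (Km nt).
  have [|nt] := boolP (config t); first by exists 0%N.
  rewrite [t]surjective_pairing in nt.
  have hL := @bihom_lagr _ _ _ al_inj be_inj t.1 t.2.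
  have [n Kn] := vanishing_koszul iso 1 1 hL (vanishing_lagr al_inj be_inj nt).
  by exists n.
have le6 : (a * d + b * c <= 6)%N.
  apply: (@intersection_bound _ al be al_inj be_inj f g a b c d (M1 + M2 + M3)) => //.
  - by move=> i j; apply: K_le (K_x (i, j)); lia.
  - by move=> i j; apply: K_le (K_y (i, j)); lia.
  - by move=> i j nij; apply: K_le (K_lagr (i, j) nij); lia.
apply: (degrees_absurd le6).
(* Both forms would contain [R], including its point on the vertical ruling of $p_2$, which is
   outside the configuration. *)
- case/andP => a1 c1.
  apply: (koszul_common_zero al_inj be_inj iso (_ : ~~ config (o4 2, o5 4))) => //.
  split; first exact: (ruling_y al_inj hf' f_config).
  exact: (ruling_y al_inj hg' g_config).
(* Both forms would contain the vertical ruling of $p_0$, including its point on the horizontal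
   ruling of $p_1$. *)
- case/andP => b1 d1.
  apply: (koszul_common_zero al_inj be_inj iso (_ : ~~ config (o4 0, o5 1))) => //.
  split; first exact: (ruling_x be_inj hf' f_config).
  exact: (ruling_x be_inj hg' g_config).
- exact: (config_x0 be_inj hf' f_config).
- exact: (config_y0 al_inj hf' f_config).
- exact: (config_y1 al_inj be_inj hf' f_config).
- case=> a1 b2; rewrite a1 b2 in hf'; case/eqP: f0.
  exact: (config_12 al_inj be_inj be4 albe albe3 hf' f_config).
- exact: (config_x0 be_inj hg' g_config).
- exact: (config_y0 al_inj hg' g_config).
- exact: (config_y1 al_inj be_inj hg' g_config).
- case=> c1 d2; rewrite c1 d2 in hg'; case/eqP: g0.
  exact: (config_12 al_inj be_inj be4 albe albe3 hg' g_config).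
Qed.

Theorem theorem3p6 (k : closedFieldType) :
  exists X1 X2 : {fset P1 k * P1 k},
    [/\ equiv_config X1 X2, VCI X1 & ~ VCI X2].
Proof.
(* Four scalars serve as the first coordinates, with their inverses as second ones; the fifth moves
   one point off the curve. Nonzero inverses leave the value 0 free for [R]. *)
have [s [s_uniq s_size s0]] := closedField_uniq k 5.
pose al (i : 'I_4) := s`_i.
have s_inj i j : (i < 5)%N -> (j < 5)%N -> s`_i = s`_j -> i = j.
  by rewrite -s_size => hi hj /eqP; rewrite nth_uniq // => /eqP.
have s_neq0 i : (i < 5)%N -> s`_i != 0.
  by rewrite -s_size => hi; apply: contraNneq s0 => <-; apply: mem_nth.
have al_inj : injective al.
  move=> i i' /s_inj eq_i; apply: val_inj; apply: eq_i.
    exact: ltn_trans (ltn_ord i) _.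
  exact: ltn_trans (ltn_ord i') _.
pose be (t : nat -> nat) (j : 'I_5) := if j == o5 4 then 0 else (s`_(t j))^-1.
have be_inj t : (forall j, (j < 4)%N -> (t j < 5)%N) -> injective t ->
    injective (be t).
  move=> t5 t_inj j j'; have lt4 (j0 : 'I_5) : j0 != o5 4 -> (t j0 < 5)%N.
    by rewrite -val_eqE /= => neq4; apply: t5; have := ltn_ord j0; lia.
  rewrite /be; case: eqP => [->|/eqP/lt4 j5]; case: eqP => [->|/eqP/lt4 j5'] //.
  - by move=> /esym/eqP; rewrite invr_eq0 (negPf (s_neq0 _ j5')).
  - by move=> /eqP; rewrite invr_eq0 (negPf (s_neq0 _ j5)).
  - by move=> /invr_inj/(s_inj _ _ j5 j5')/t_inj/val_inj.
have albe (t : nat -> nat) (i : 'I_4) (j : 'I_5) : t i = i -> i = j :> nat ->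
    al i * be t j = 1.
  move=> ti ij; rewrite /be -val_eqE /= -ij ltn_eqF // ti.
  by rewrite /al mulfV // s_neq0 // ltnW // ltnS.
(* The swap keeps three diagonal points on the curve and gives the fourth the second coordinate
   $s_4^{-1}\ne s_3^{-1}$; being injective on all naturals, it fits [be_inj]. *)
pose swap j := (if j == 3 then 4 else if j == 4 then 3 else j)%N.
have be_id : injective (be id) by apply: be_inj => // j; lia.
have be_swap : injective (be swap).
  apply: be_inj => [j|j j']; rewrite /swap; first by do 2?case: eqP; lia.
  by do 4?case: eqP; lia.
exists (grid al (be id)), (grid al (be swap)); split.
- exact: grid_equiv.
- by apply: VCI_grid => // i j; apply: albe.
- apply: not_VCI_grid => //.
  + by move=> i j i3; apply: albe; rewrite /swap !ltn_eqF // ltnW.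
  + rewrite /al /be /=; apply/eqP => /(congr1 (fun x => x * s`_4)).
    by rewrite mulfVK ?s_neq0 // mul1r => /s_inj; move=> /(_ isT isT).
Qed.
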